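(* Let $\Lambda$ be a row-finite source-free $k$-graph and let $\pi$ be an irreducible representation of $C^*(\Lambda)$ arising from a $\Lambda$-semibranching function system on a measure space $(X,\mu)$, where $\mu$ has an atom. Then $\pi$ is monic.
   Context: A $k$-graph is a countable small category $\Lambda$ with a functor $d:\Lambda\to\mathbb{N}^k$ with unique factorization; vertices $\Lambda^0$, range/source $r,s$; row-finite/source-free: each $v\Lambda^n$ (paths of degree $n$ with range $v$) is finite/nonempty. $C^*(\Lambda)$ is the universal $C^*$-algebra of a Cuntz–Krieger $\Lambda$-family $\{s_\lambda\}$ ($\{s_v\}$ orthogonal projections, $s_\lambda s_\eta=s_{\lambda\eta}$, $s_\lambda^*s_\lambda=s_{s(\lambda)}$, $s_v=\sum_{\lambda\in v\Lambda^n}s_\lambda s_\lambda^*$). A $\Lambda$-semibranching function system on $(X,\mu)$: measurable $D_\lambda$, prefixing maps $\tau_\lambda:D_\lambda\to X$ with ranges $R_\lambda$, coding maps $\tau^m:X\to X$ such that for each $m$ the family $\{\tau_\lambda:d(\lambda)=m\}$ is a semibranching function system with coding map $\tau^m$ ($0<\mu(D_\lambda)<\infty$, $R_\lambda$ of finite measure, pairwise a.e. disjoint, covering $X$ a.e., $\Phi_\lambda=d(\mu\circ\tau_\lambda)/d\mu>0$ a.e. on $D_\lambda$, $\tau^m\circ\tau_\lambda=\mathrm{id}$), $\tau_v=\mathrm{id}$, $R_\nu\subseteq D_\lambda$ a.e. and $\tau_\lambda\tau_\nu=\tau_{\lambda\nu}$ a.e. for $\nu\in s(\lambda)\Lambda$,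 and $\tau^m\tau^n=\tau^{m+n}$. The representation arising from it is $\pi(s_\lambda)\xi(x)=\chi_{R_\lambda}(x)\Phi_\lambda(\tau^{d(\lambda)}(x))^{-1/2}\xi(\tau^{d(\lambda)}(x))$ on $L^2(X,\mu)$. A representation $\{t_\lambda\}$ on $\mathcal H$ is monic if all $t_\lambda\ne0$ and there is $\xi\in\mathcal H$ with $\overline{\mathrm{span}}\{t_\lambda t_\lambda^*\xi:\lambda\in\Lambda\}=\mathcal H$. *)

(* Defs.v *)
From HB Require Import structures.
From mathcomp Require Import all_boot all_order all_algebra.
From mathcomp Require Import all_classical all_reals all_analysis.
From mathcomp Require Import complex.
From Stdlib Require List.

Set Implicit Arguments.
Unset Strict Implicit.
Unset Printing Implicit Defensive.

Import Order.TTheory GRing.Theory Num.Theory.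
Local Open Scope classical_set_scope.
Local Open Scope ring_scope.
Local Open Scope complex_scope.

Definition degadd (k : nat) (m n : 'I_k -> nat) : 'I_k -> nat :=
  fun i => (m i + n i)%N.

(* A k-graph: a countable small category (objects [kvert], morphisms
   [kpath], range [kr] = codomain, source [ks] = domain, identities [kid],
   composition [kcomp l m] = "l m", defined when ks l = kr m) together with a
   degree functor [kdeg] to N^k having the unique factorization property. *)
Record kgraph (k : nat) := KGraph {
  kvert : countType;
  kpath : countType;
  kr : kpath -> kvert;
  ks : kpath -> kvert;
  kid : kvert -> kpath;
  kcomp : kpath -> kpath -> kpath;
  kdeg : kpath -> 'I_k -> nat;
  kr_id : forall v, kr (kid v) = v;
  ks_id : forall v, ks (kid v) = v;
  kr_comp : forall l m, ks l = kr m -> kr (kcomp l m) = kr l;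
  ks_comp : forall l m, ks l = kr m -> ks (kcomp l m) = ks m;
  kcomp_idl : forall l, kcomp (kid (kr l)) l = l;
  kcomp_idr : forall l, kcomp l (kid (ks l)) = l;
  kcompA : forall l m n, ks l = kr m -> ks m = kr n ->
    kcomp l (kcomp m n) = kcomp (kcomp l m) n;
  kdeg_id : forall v, kdeg (kid v) = (fun _ => 0%N);
  kdeg_comp : forall l m, ks l = kr m ->
    kdeg (kcomp l m) = degadd (kdeg l) (kdeg m);
  kfact : forall l (m n : 'I_k -> nat), kdeg l = degadd m n ->
    exists! p : kpath * kpath,
      [/\ ks p.1 = kr p.2, kdeg p.1 = m, kdeg p.2 = n & l = kcomp p.1 p.2]
}.

Definition vLn (k : nat) (L : kgraph k) (v : kvert L) (n : 'I_k -> nat)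
  : set (kpath L) := [set l | kr l = v /\ kdeg l = n].

Definition row_finite (k : nat) (L : kgraph k) : Prop :=
  forall (v : kvert L) n, finite_set (vLn v n).

Definition source_free (k : nat) (L : kgraph k) : Prop :=
  forall (v : kvert L) n, vLn v n !=set0.

(* Data: domains [sD l], prefixing maps [stau l] (meaningful on [sD l]),
   coding maps [scode m], and Radon-Nikodym derivatives [sPhi l] of
   mu o tau_l with respect to mu (on D_l). The range R_l is the image
   [stau l @` sD l]. *)
Record LSBFS (k : nat) (L : kgraph k) (R : realType) (d : measure_display)
  (X : measurableType d) (mu : {measure set X -> \bar R}) := MkLSBFS {
  sD : kpath L -> set X;
  stau : kpath L -> X -> X;
  scode : ('I_k -> nat) -> X -> X;
  sPhi : kpath L -> X -> R;
  (* for each m, {tau_l : d(l) = m} is a semibranching function system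
     with coding map tau^m *)
  sD_meas : forall l, measurable (sD l);
  sD_pos : forall l, (0 < mu (sD l))%E;
  sD_fin : forall l, (mu (sD l) < +oo)%E;
  stau_meas : forall l, measurable_fun (sD l) (stau l);
  sR_meas : forall l, measurable (stau l @` sD l);
  sR_fin : forall l, (mu (stau l @` sD l) < +oo)%E;
  sR_disj : forall l l', kdeg l = kdeg l' -> l <> l' ->
    mu ((stau l @` sD l) `&` (stau l' @` sD l')) = 0%E;
  sR_cover : forall m,
    mu (~` \bigcup_(l in [set l | kdeg l = m]) (stau l @` sD l)) = 0%E;
  sPhi_meas : forall l, measurable_fun (sD l) (sPhi l);
  sPhi_RN : forall l A, measurable A -> A `<=` sD l ->
    measurable (stau l @` A) /\
    mu (stau l @` A) = (\int[mu]_(x in A) (sPhi l x)%:E)%E;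
  sPhi_pos : forall l, {ae mu, forall x, sD l x -> 0 < sPhi l x};
  scode_meas : forall m, measurable_fun setT (scode m);
  scode_tau : forall l x, sD l x -> scode (kdeg l) (stau l x) = x;
  stau_vert : forall v x, sD (kid v) x -> stau (kid v) x = x;
  sR_sub : forall l n, ks l = kr n ->
    mu ((stau n @` sD n) `\` sD l) = 0%E;
  scomp_dom : forall l n, ks l = kr n ->
    mu (sD n `\` sD (kcomp l n)) = 0%E /\ mu (sD (kcomp l n) `\` sD n) = 0%E;
  scomp : forall l n, ks l = kr n ->
    {ae mu, forall x, sD n x -> stau l (stau n x) = stau (kcomp l n) x};
  scode_add : forall m n x, scode m (scode n x) = scode (degadd m n) x
}.

Definition sR (k : nat) (L : kgraph k) (R : realType) (d : measure_display)
  (X : measurableType d) (mu : {measure set X -> \bar R})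
  (S : LSBFS L mu) (l : kpath L) : set X := stau S l @` sD S l.

(* The operator pi(s_l) of the representation arising from S, acting on
   (representatives of elements of) L^2(X, mu):
   pi(s_l) xi (x) = chi_{R_l}(x) Phi_l(tau^{d(l)}(x))^{-1/2} xi(tau^{d(l)}(x)). *)
Definition sbfs_op (k : nat) (L : kgraph k) (R : realType)
  (d : measure_display) (X : measurableType d)
  (mu : {measure set X -> \bar R}) (S : LSBFS L mu) (l : kpath L)
  (xi : X -> R[i]) : X -> R[i] :=
  fun x => if `[< sR S l x >] then
      ((Num.sqrt (sPhi S l (scode S (kdeg l) x)))^-1)%:C
        * xi (scode S (kdeg l) x)
    else 0.

Definition sqmod (R : realType) (z : R[i]) : R := (complex.Re z) ^+ 2 + (complex.Im z) ^+ 2.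

Definition L2set (R : realType) (d : measure_display) (X : measurableType d)
  (mu : {measure set X -> \bar R}) : set (X -> R[i]) :=
  [set xi | [/\ measurable_fun setT (fun x => complex.Re (xi x)),
               measurable_fun setT (fun x => complex.Im (xi x)) &
               (\int[mu]_x (sqmod (xi x))%:E < +oo)%E]].

Definition inner (R : realType) (d : measure_display) (X : measurableType d)
  (mu : {measure set X -> \bar R}) (f g : X -> R[i]) : R[i] :=
  Complex (Rintegral mu setT (fun x => complex.Re (f x * conjc (g x))))
          (Rintegral mu setT (fun x => complex.Im (f x * conjc (g x)))).

Definition l2dist (R : realType) (d : measure_display) (X : measurableType d)
  (mu : {measure set X -> \bar R}) (f g : X -> R[i]) : R :=
  Num.sqrt (Rintegral mu setT (fun x => sqmod (f x - g x))).

Definition ae_zero (R : realType) (d : measure_display) (X : measurableType d)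
  (mu : {measure set X -> \bar R}) (f : X -> R[i]) : Prop :=
  {ae mu, forall x, f x = 0}.

Definition is_adj_image (R : realType) (d : measure_display)
  (X : measurableType d) (mu : {measure set X -> \bar R})
  (T : (X -> R[i]) -> (X -> R[i])) (xi zeta : X -> R[i]) : Prop :=
  L2set mu zeta /\
  forall eta, L2set mu eta -> inner mu (T eta) xi = inner mu eta zeta.

(* S (a set of representatives, saturated under a.e. equality) is a closed
   linear subspace of L^2(X, mu) *)
Definition closed_subspace (R : realType) (d : measure_display)
  (X : measurableType d) (mu : {measure set X -> \bar R})
  (S : set (X -> R[i])) : Prop :=
  [/\ S `<=` L2set mu,
      S (fun _ => 0),
      (forall f g, S f -> S g -> S (fun x => f x + g x)),
      (forall (c : R[i]) f, S f -> S (fun x => c * f x)) &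
      (forall f g, S f -> L2set mu g -> {ae mu, forall x, f x = g x} -> S g)] /\
  (forall f, L2set mu f ->
     (forall e : R, 0 < e -> exists g, S g /\ l2dist mu f g < e) -> S f).

(* The representation pi of C^*(Lambda) arising from S is irreducible:
   the only closed subspaces invariant under pi(C^*(Lambda)), i.e. under all
   pi(s_l) and pi(s_l)^* (which generate pi(C^*(Lambda)) as a C^*-algebra),
   are {0} and L^2(X, mu). *)
Definition sbfs_irreducible (k : nat) (L : kgraph k) (R : realType)
  (d : measure_display) (X : measurableType d)
  (mu : {measure set X -> \bar R}) (S : LSBFS L mu) : Prop :=
  forall V : set (X -> R[i]), closed_subspace mu V ->
    (forall l f, V f -> V (sbfs_op S l f)) ->
    (forall l f, V f -> exists g, V g /\ is_adj_image mu (sbfs_op S l) f g) ->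
    V `<=` ae_zero mu \/ L2set mu `<=` V.

(* The representation arising from S is monic: every pi(s_l) is nonzero and
   there is xi in L^2 with closed span {pi(s_l) pi(s_l)^* xi} = L^2. *)
Definition sbfs_monic (k : nat) (L : kgraph k) (R : realType)
  (d : measure_display) (X : measurableType d)
  (mu : {measure set X -> \bar R}) (S : LSBFS L mu) : Prop :=
  (forall l, exists f, L2set mu f /\ ~ ae_zero mu (sbfs_op S l f)) /\
  exists xi, L2set mu xi /\
    forall eta, L2set mu eta -> forall e : R, 0 < e ->
      exists s : seq ((R[i] * kpath L) * (X -> R[i])),
        (forall p, List.In p s -> is_adj_image mu (sbfs_op S p.1.2) xi p.2) /\
        l2dist mu eta
          (fun x => \sum_(p <- s) p.1.1 * sbfs_op S p.1.2 p.2 x) < e.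

Definition has_atom (R : realType) (d : measure_display) (X : measurableType d)
  (mu : {measure set X -> \bar R}) : Prop :=
  exists A, [/\ measurable A, (0 < mu A)%E &
    forall B, measurable B -> B `<=` A -> mu B = 0%E \/ mu (A `\` B) = 0%E].

(* Main.v *)
(* Up to null sets, an atom is a point on which the coding maps act and which
   has an infinite path: the one whose initial segments [l] satisfy that the
   atom lies in R_l. For an atom a, the functions in L^2 vanishing on all atoms
   tail equivalent to a form an invariant subspace, so irreducibility forces X
   to be a countable union of atoms, all tail equivalent; the normalized
   indicator functions are then an orthonormal basis, on which the operators
   pi(s_l) act by partial permutations.

   Two distinct atoms with the same infinite path would give a nontrivial
   permutation u of the atoms commuting with all these partial permutations.
   If u has a finite orbit, the u-invariant functions form a proper nonzero
   invariant subspace. Otherwise, let c be the sequence of Fourier coefficients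
   of the indicator function of a half circle whose mirror image is the
   complementary half circle, so that sum_j c_j c_(j+n) = 0 for all n; then the
   functions whose coordinates satisfy sum_j c_j f(u^j p) = 0 for all p form a
   proper nonzero invariant subspace. Hence an atom is determined by its
   infinite path, i.e. it is the intersection of the sets R_l containing it.
   Since pi(s_l) pi(s_l)^* multiplies by the indicator function of R_l, every xi
   in L^2 without zeros is then cyclic for these projections. *)
Require Import Defs.
From HB Require Import structures.
From mathcomp Require Import all_boot all_order all_algebra.
From mathcomp Require Import all_classical all_reals all_analysis.
From mathcomp Require Import complex.
From mathcomp Require Import measurable_realfun lra ring zify.
Set Implicit Arguments.
Unset Strict Implicit.
Unset Printing Implicit Defensive.
Import Order.TTheory GRing.Theory Num.Theory.
Import numFieldNormedType.Exports.
Local Open Scope classical_set_scope.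
Local Open Scope ring_scope.

(** * Change of variables *)

(** [X] is only a measurable space, so an atom is not a point: it is handled through the sets
    containing it up to null sets. This family is closed under countable intersections and decides
    every measurable set; the coding and prefixing maps transport such families.

    The permutation [u] arises as follows. If [p] and [q] have the same infinite path [x], tail
    equivalence gives [sig a p = sig b q], so [x] shifted by [a] equals [x] shifted by [b]. Every
    atom [r] is tail equivalent to [p], hence far enough along its path has the same periodicity;
    replacing its initial segment of degree [a + c] by the one of degree [b + c] leaves its path
    unchanged, and [u r] is the resulting atom.

    On an infinite orbit, nonzero [u]-invariant functions are not square summable. Identify the
    orbit with the integers and its square summable functions with functions [F] on the circle:
    translation by [u] becomes multiplication by a character, and the invariant subspaces sought are
    those of functions vanishing on part of the circle. If [g] has Fourier coefficients [c], then
    [sum_j c_j f(u^j p) = 0] along the orbit says [F(x) g(-x) = 0]. For [g] the indicator of a half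
    circle, [g] itself is a solution. *)

Section ImageIntegral.
Local Open Scope ereal_scope.
Context (R : realType) (d : measure_display) (X : measurableType d).
Variables (mu : {measure set X -> \bar R}) (D : set X) (tau : X -> X)
  (Phi : X -> R).
Hypotheses (mD : measurable D) (mtau : measurable_fun D tau)
  (mPhi : measurable_fun D Phi)
  (Phi_gt0 : {ae mu, forall x, D x -> (0 < Phi x)%R})
  (tauRN : forall A, measurable A -> A `<=` D ->
    measurable (tau @` A) /\
    mu (tau @` A) = \int[mu]_(x in A) (Phi x)%:E).

Import HBNNSimple.

(** The Radon-Nikodym identity is the case of indicator functions; simple functions follow by
    linearity and the general case by monotone convergence. As [Phi] is positive only almost
    everywhere on [D], the density is written with an absolute value, which keeps the integrand
    nonnegative everywhere. *)
Lemma ge0_integral_image (G : X -> \bar R) :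
  measurable_fun setT G -> (forall x, 0 <= G x) ->
  \int[mu]_(x in tau @` D) G x =
  \int[mu]_(x in D) (G (tau x) * `|Phi x|%:E).
Proof.
move=> mG G0.
have [mR _] := tauRN mD (@subset_refl _ D).
have mPhiE : measurable_fun D (fun x => `|Phi x|%:E : \bar R).
  by apply/measurable_EFinP; exact: measurableT_comp.
have imE Z : measurable Z ->
    mu (Z `&` tau @` D) = \int[mu]_(x in D `&` tau @^-1` Z) `|Phi x|%:E.
  move=> mZ.
  have mDZ : measurable (D `&` tau @^-1` Z) by exact: mtau.
  have -> : Z `&` tau @` D = tau @` (D `&` tau @^-1` Z).
    apply/seteqP; split=> [x [Zx [y Dy yx]]|_ [y [Dy Zy] <-]].
      by exists y => //; split => //=; rewrite yx.
    by split=> //; exists y.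
  rewrite (tauRN mDZ _).2; last by move=> ? [].
  apply: ae_eq_integral => //.
  - by apply: measurable_funS (iffRL (measurable_EFinP _ _) mPhi).
  - by apply: measurable_funS mPhiE.
  - by apply: filterS Phi_gt0 => x + [Dx _] => /(_ Dx) /ltW P; rewrite ger0_norm.
have mTT : measurable [set: X] by [].
pose h := nnsfun_approx mTT mG.
have hcvg x : EFin \o h ^~ x @ \oo --> G x by exact: (cvg_nnsfun_approx mTT mG).
have hnd x a b : (a <= b)%N -> (h a x <= h b x)%R.
  by move=> ab; exact/lefP/nd_nnsfun_approx.
have mh n (E : set X) : measurable_fun E (EFin \o h n).
  by apply/measurable_EFinP; apply: measurable_funTS; exact/measurable_funP.
have mht n : measurable_fun D (fun x => (h n (tau x))%:E).
  apply: (@measurable_comp _ _ _ _ _ _ setT (EFin \o h n)) => //.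
have -> : \int[mu]_(x in tau @` D) G x =
    lim (\int[mu]_(x in tau @` D) (EFin \o h n) x @[n --> \oo]).
  rewrite -monotone_convergence//.
  - by apply: eq_integral => x _; apply/esym/cvg_lim => //; exact: hcvg.
  - by move=> n x _; rewrite lee_fin.
  - by move=> x _ a b ab; rewrite lee_fin; exact: hnd.
have -> : \int[mu]_(x in D) (G (tau x) * `|Phi x|%:E) =
    lim (\int[mu]_(x in D) ((h n (tau x))%:E * `|Phi x|%:E) @[n --> \oo]).
  rewrite -monotone_convergence//.
  - apply: eq_integral => x _; apply/esym/cvg_lim => //.
    by apply: cvgeZr => //; exact: hcvg.
  - by move=> n; apply: emeasurable_funM.
  - by move=> n x _; rewrite mule_ge0// lee_fin.
  - by move=> x _ a b ab; rewrite lee_wpmul2r ?lee_fin//; exact: hnd.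
suff suf n : \int[mu]_(x in tau @` D) (EFin \o h n) x =
    \int[mu]_(x in D) ((h n (tau x))%:E * `|Phi x|%:E).
  by under eq_fun do rewrite suf.
have indich (E : set X) r :
    measurable_fun E (fun x => (r * \1_(h n @^-1` [set r]) x)%:E).
  by apply: (measurable_comp measurableT) => //; exact: measurable_funM.
transitivity (\int[mu]_(x in tau @` D)
   (\sum_(y \in range (h n)) (y * \1_(h n @^-1` [set y]) x)%:E)).
  by apply: eq_integral => t tE; rewrite /= fimfunE -fsumEFin.
rewrite ge0_integral_fsum//; last by move=> m y Ey; exact: nnfun_muleindic_ge0.
transitivity (\int[mu]_(x in D) (\sum_(y \in range (h n))
    (y * \1_(h n @^-1` [set y]) (tau x))%:E * `|Phi x|%:E)); last first.
  apply: eq_integral => x xE.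
  rewrite -ge0_mule_fsuml => [|y]; last exact: nnfun_muleindic_ge0.
  by rewrite fsumEFin // -(fimfunE _ (tau x)).
have indicht r :
    measurable_fun D (fun x => (r * \1_(h n @^-1` [set r]) (tau x))%:E).
  exact: (@measurable_comp _ _ _ _ _ _ setT
    (fun x => (r * \1_(h n @^-1` [set r]) x)%:E)).
rewrite ge0_integral_fsum//; last 2 first.
  - by move=> y; apply: emeasurable_funM.
  - by move=> m y Ey; rewrite mule_ge0 ?lee_fin// -lee_fin nnfun_muleindic_ge0.
apply: eq_fsbigr => r rhn.
under eq_integral do rewrite EFinM.
rewrite integralZl_indic_nnsfun => //.
under [RHS]eq_integral do rewrite EFinM -muleA.
rewrite ge0_integralZl//; last 2 first.
- apply: emeasurable_funM => //; apply/measurable_EFinP.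
  exact: (@measurable_comp _ _ _ _ _ _ setT).
- by move: rhn; rewrite inE => -[t _ <-]; rewrite lee_fin.
congr (_ * _).
have mhr : measurable (h n @^-1` [set r]) by [].
rewrite integral_indic// imE// integral_mkcondr.
apply: eq_integral => x _; rewrite patchE indicE.
have -> : (x \in tau @^-1` (h n @^-1` [set r])) = (tau x \in h n @^-1` [set r]).
  by apply/idP/idP; rewrite !inE.
by case: ifP => _; rewrite ?mul1e ?mul0e.
Qed.

Lemma integral_image (G : X -> R) : measurable_fun setT G ->
  \int[mu]_(x in tau @` D) (G x)%:E =
  \int[mu]_(x in D) (G (tau x) * `|Phi x|)%:E.
Proof.
move=> mG; rewrite integralE [RHS]integralE.
have mGE : measurable_fun setT (EFin \o G) by exact/measurable_EFinP.
have pos : (fun x => (G (tau x) * `|Phi x|)%:E)^\+ =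
    (fun x => (EFin \o G)^\+ (tau x) * `|Phi x|%:E).
  apply/funext => x; rewrite !funeposE /= -!EFin_max -EFinM; congr EFin.
  by rewrite maxr_pMl// mul0r.
have neg : (fun x => (G (tau x) * `|Phi x|)%:E)^\- =
    (fun x => (EFin \o G)^\- (tau x) * `|Phi x|%:E).
  apply/funext => x; rewrite !funenegE /= -?EFinN -!EFin_max -EFinM; congr EFin.
  by rewrite maxr_pMl// mul0r mulNr.
rewrite pos neg; congr (_ - _); apply: ge0_integral_image => //.
- exact: measurable_funepos.
- exact: measurable_funeneg.
Qed.

(** The integral of [Phi] over a measurable subset of [D] vanishes exactly when the subset is null,
    because [Phi] is positive there. This is what makes the prefixing maps act on atoms, which are
    defined only up to null sets. *)
Lemma image_negligible (A : set X) : A `<=` D ->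
  mu.-negligible (tau @` A) <-> mu.-negligible A.
Proof.
move=> AD; split=> [[N [mN N0 AN]]|[N [mN N0 AN]]].
  have mM : measurable (D `&` tau @^-1` N) by exact: mtau.
  have MD : (D `&` tau @^-1` N) `<=` D by move=> ? [].
  exists (D `&` tau @^-1` N); split=> //; last first.
    by move=> x Ax; split; [exact: AD|apply: AN; exists x].
  have [mtM tM] := tauRN mM MD.
  have tM0 : mu (tau @` (D `&` tau @^-1` N)) = 0.
    by apply: (subset_measure0 _ _ _ N0) => // _ [y [_ Ny] <-].
  have mPhiM : measurable_fun (D `&` tau @^-1` N) (EFin \o Phi).
    by apply/measurable_EFinP; apply: measurable_funS mPhi.
  have : \int[mu]_(x in D `&` tau @^-1` N) `|(EFin \o Phi) x| = 0.
    rewrite -[RHS]tM0 tM; apply: ae_eq_integral => //.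
    - exact: measurableT_comp.
    - apply: filterS Phi_gt0 => x + [Dx _] => /(_ Dx) /ltW P.
      by rewrite /= ger0_norm.
  move/(ae_eq_integral_abs mu mM mPhiM) => e0.
  apply/(negligibleP _ mM).
  have [B [mB B0 sB]] : {ae mu, forall x, ~ (D `&` tau @^-1` N) x}.
    apply: filterS2 Phi_gt0 e0 => x P E Mx; move: (E Mx) (P Mx.1) => -[->].
    by rewrite ltxx.
  by exists B; split => // x Mx; apply: sB => /=; apply.
have mM : measurable (D `&` N) by exact: measurableI.
have MD : (D `&` N) `<=` D by move=> ? [].
have [mtM tM] := tauRN mM MD.
exists (tau @` (D `&` N)); split=> //; last first.
  by move=> _ [x Ax <-]; exists x => //; split; [exact: AD|exact: AN].
have M0 : mu (D `&` N) = 0 by apply: (subset_measure0 _ _ _ N0).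
have mPhiM : measurable_fun (D `&` N) (EFin \o Phi).
  by apply/measurable_EFinP; apply: measurable_funS mPhi.
rewrite tM (ae_eq_integral (cst 0)) ?integral0//.
exact: ae_eq0.
Qed.

End ImageIntegral.

(** * Atoms *)

Section Sqmod.
Context (R : realType).
Implicit Types x y z : R[i].

Lemma sqmod_ge0 z : 0 <= sqmod z.
Proof. by rewrite /sqmod addr_ge0 ?sqr_ge0. Qed.

Lemma sqmod0 : sqmod (0 : R[i]) = 0.
Proof. by rewrite /sqmod /= expr0n addr0. Qed.

Lemma sqmod_eq0 z : sqmod z = 0 -> z = 0.
Proof.
case: z => a b; rewrite /sqmod /= => /eqP.
by rewrite paddr_eq0 ?sqr_ge0// !sqrf_eq0 => /andP[/eqP -> /eqP ->].
Qed.

Lemma sqmodM x y : sqmod (x * y) = sqmod x * sqmod y.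
Proof. by case: x => a b; case: y => a' b'; rewrite /sqmod /=; ring. Qed.

Lemma sqmodR (a : R) : sqmod a%:C%C = a ^+ 2.
Proof. by rewrite /sqmod /= expr0n addr0. Qed.

Lemma sqmodN z : sqmod (- z) = sqmod z.
Proof. by case: z => a b; rewrite /sqmod /= !sqrrN. Qed.

(** Parallelogram identity. It replaces the triangle inequality, so estimates stay at the level of
    squared norms and tolerances are split into quarters. *)
Lemma sqmodD_le x y : sqmod (x + y) <= 2 * sqmod x + 2 * sqmod y.
Proof.
case: x => a b; case: y => a' b'; rewrite /sqmod /= -subr_ge0.
rewrite (_ : _ - _ = (a - a') ^+ 2 + (b - b') ^+ 2); last by ring.
by rewrite addr_ge0 ?sqr_ge0.
Qed.

(** Induction step of the Cauchy-Schwarz inequality: expanding [|H x - a conj(h)|^2 >= 0], bounding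
    [|a|^2] by [H Y] and dividing by [H] controls the mixed term. *)
Lemma sqmod_cauchy_step (a h x : R[i]) (H Y : R) : 0 <= H -> 0 <= Y ->
  sqmod a <= H * Y -> sqmod (a + h * x) <= (H + sqmod h) * (Y + sqmod x).
Proof.
move=> H0 Y0 aHY.
have : sqmod (H%:C%C * x - a * conjc h) >= 0 by exact: sqmod_ge0.
have [H_eq0|Hp] := eqVneq H 0.
  move: aHY; rewrite H_eq0 mul0r => a0 _; have -> : a = 0.
    by apply: sqmod_eq0; apply/eqP; rewrite eq_le a0 sqmod_ge0.
  by rewrite !add0r sqmodM ler_wpM2l ?sqmod_ge0// lerDr.
have {}Hp : 0 < H by rewrite lt_def Hp.
move: aHY; case: a => a b; case: h => h k; case: x => x y.
rewrite /sqmod /= => aHY E.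
rewrite -(ler_pM2l Hp).
have K : (a ^+ 2 + b ^+ 2) * (h ^+ 2 + k ^+ 2) <= H * Y * (h ^+ 2 + k ^+ 2).
  by rewrite ler_wpM2r// addr_ge0 ?sqr_ge0.
have K2 : H * (a ^+ 2 + b ^+ 2) <= H * (H * Y) by rewrite ler_wpM2l// ltW.
lra.
Qed.

Lemma sqmod_cauchy (I : Type) (s : seq I) (h x : I -> R[i]) :
  sqmod (\sum_(i <- s) h i * x i) <=
  (\sum_(i <- s) sqmod (h i)) * (\sum_(i <- s) sqmod (x i)).
Proof.
elim: s => [|i s IH]; first by rewrite !big_nil sqmod0 mul0r.
rewrite !big_cons addrC [X in _ <= X * _]addrC [X in _ <= _ * X]addrC.
by apply: sqmod_cauchy_step => //; apply: sumr_ge0 => j _; exact: sqmod_ge0.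
Qed.

Lemma measurable_sqmod (d : measure_display) (X : measurableType d) (D : set X)
  (f : X -> R[i]) :
  measurable_fun D (fun t => complex.Re (f t)) ->
  measurable_fun D (fun t => complex.Im (f t)) ->
  measurable_fun D (fun t => sqmod (f t)).
Proof.
by move=> mRe mIm; apply: measurable_funD; exact: measurable_funX.
Qed.

End Sqmod.

Section Atoms.
Context (R : realType) (d : measure_display) (X : measurableType d).
Variable mu : {measure set X -> \bar R}.

Definition fin_atom (A : set X) : Prop :=
  [/\ measurable A, (0 < mu A)%E, (mu A < +oo)%E &
    forall B, measurable B -> B `<=` A -> mu B = 0%E \/ mu (A `\` B) = 0%E].

Definition germ (A : set X) : set (set X) := [set Z | mu.-negligible (A `\` Z)].

(* Atoms up to null sets, encoded by the filter of sets containing them almost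
   everywhere. *)
Definition atom : Type := {p : set (set X) | exists A, fin_atom A /\ p = germ A}.

Implicit Types (p q : atom) (Y Z : set X).

Definition rep p : set X := sval (cid (svalP p)).
Definition on p Z : Prop := sval p Z.

Lemma rep_atom p : fin_atom (rep p).
Proof. by rewrite /rep; case: cid => A [/= ]. Qed.

Lemma onE p Z : on p Z <-> mu.-negligible (rep p `\` Z).
Proof. by rewrite /on /rep; case: cid => A [/= _ ->]. Qed.

Lemma m_rep p : measurable (rep p).
Proof. by have [] := rep_atom p. Qed.

Lemma on_rep p : on p (rep p).
Proof. by apply/onE; rewrite setDv; exact: negligible_set0. Qed.

Lemma onS p Y Z : Y `<=` Z -> on p Y -> on p Z.
Proof.
by move=> YZ /onE n; apply/onE; apply: negligibleS n; exact: setDS.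
Qed.

Lemma onI p Y Z : on p Y -> on p Z -> on p (Y `&` Z).
Proof.
by move=> /onE n1 /onE n2; apply/onE; rewrite setDIr; exact: negligibleU.
Qed.

Lemma on_ae p (P : set X) : {ae mu, forall x, P x} -> on p P.
Proof. by move=> aeP; apply/onE; apply: negligibleS aeP => x []. Qed.

Lemma onT p : on p setT.
Proof. by apply: on_ae; exact: aeW. Qed.

Lemma on_null p Z : mu.-negligible Z -> on p (~` Z).
Proof. by move=> n; apply/onE; apply: negligibleS n => x [_ /contrapT]. Qed.

(** Together with the zero-one law [on_or], this is what lets an atom play the role of a point. *)
Lemma on_bigcap (I : countType) p (F : I -> set X) :
  (forall i, on p (F i)) -> on p (\bigcap_i F i).
Proof.
move=> pF; apply/onE.
pose G n := if unpickle n is Some i then rep p `\` F i else set0.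
apply: (@negligibleS _ _ _ _ (\bigcup_n G n)).
  move=> x [rx /existsNP[i /not_implyP[_ nFx]]].
  by exists (pickle i) => //; rewrite /G pickleK.
apply: negligible_bigcup => n; rewrite /G; case: unpickle => [i|].
  exact/onE.
exact: negligible_set0.
Qed.

Lemma not_on0 p : ~ on p set0.
Proof.
move=> /onE; rewrite setD0; have [mA A0 _ _] := rep_atom p.
by move=> /(measure_negligible mA) E; rewrite E ltxx in A0.
Qed.

Lemma on_or p Z : measurable Z -> on p Z \/ on p (~` Z).
Proof.
move=> mZ; have [mA _ _ /(_ (rep p `&` Z) (measurableI _ _ mA mZ))] := rep_atom p.
case; first by move=> ? [].
  move=> E; right; apply/onE; rewrite setDE setCK.
  by apply/negligibleP => //; exact: measurableI.
rewrite setDIr setDv set0U => E; left; apply/onE/negligibleP => //.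
exact: measurableD.
Qed.

Lemma on_both p Y Z : on p Y -> on p Z -> Y `&` Z !=set0.
Proof.
move=> pY pZ; apply/set0P/eqP => E; apply: (@not_on0 p).
by rewrite -E; exact: onI.
Qed.

Lemma on_bigcup (I : countType) p (F : I -> set X) :
  (forall i, measurable (F i)) -> on p (\bigcup_i F i) -> exists i, on p (F i).
Proof.
move=> mF pF; apply: contrapT => /forallNP nF.
have /(on_both pF)[x [[i _ Fx] /(_ i Logic.I)]] : on p (\bigcap_i ~` F i) by
  apply: on_bigcap => i; have [/nF|] := on_or p (mF i).
by apply.
Qed.

Lemma on_pos p Z : measurable Z -> on p Z -> (0 < mu Z)%E.
Proof.
move=> mZ pZ; rewrite lt0e measure_ge0 andbT; apply/eqP => Z0.
have /on_both : on p (~` Z) by apply: on_null; apply/negligibleP.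
by move=> /(_ _ pZ)[x []].
Qed.

Lemma atom_ext p q : (forall Z, on p Z <-> on q Z) -> p = q.
Proof.
case: p => p hp; case: q => q hq E; apply: eq_exist.
by apply/predeqP => Z; exact: E.
Qed.

(** The overlap of the two representatives has positive measure, so it is almost all of the atom
    [rep q]; thus each representative contains the other almost everywhere. *)
Lemma on_repP p q : on p (rep q) -> p = q.
Proof.
move=> pq; have [mp p0 _ _] := rep_atom p; have [mq q0 _ qB] := rep_atom q.
have mI : measurable (rep q `&` rep p) by exact: measurableI.
have I0 : (0 < mu (rep q `&` rep p))%E.
  by apply: (@on_pos p) => //; apply: onI => //; exact: on_rep.
have qp : on q (rep p).
  case: (qB _ mI (@subIsetl _ _ _)); first by move=> E; rewrite E ltxx in I0.
  rewrite setDIr setDv set0U => E; apply/onE/negligibleP => //.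
  exact: measurableD.
apply: atom_ext => Z; split=> h; apply/onE.
  have := onI pq h => /onE; have := qp => /onE n1 n2.
  apply: negligibleS (negligibleU n1 n2) => x [qx nZ].
  by have [px|npx] := pselect (rep p x); [right|left]; split => // -[].
have := onI qp h => /onE; have := pq => /onE n1 n2.
apply: negligibleS (negligibleU n1 n2) => x [qx nZ].
by have [px|npx] := pselect (rep q x); [right|left]; split => // -[].
Qed.

Lemma on_ext p q : (forall Z, measurable Z -> on p Z -> on q Z) -> p = q.
Proof.
by move=> h; apply/esym/on_repP; apply: h; [exact: m_rep|exact: on_rep].
Qed.

Lemma on_neq p q : p <> q -> on p (~` rep q).
Proof. by move=> pq; have [/on_repP|] := on_or p (m_rep q). Qed.

Definition weight p : R := fine (mu (rep p)).

Lemma mu_rep p : mu (rep p) = (weight p)%:E.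
Proof.
have [_ /ltW A0 Aoo _] := rep_atom p.
by rewrite fineK// ge0_fin_numE.
Qed.

Lemma weight_gt0 p : 0 < weight p.
Proof. by rewrite -lte_fin -mu_rep; have [] := rep_atom p. Qed.

Lemma mu_on p Z : measurable Z -> on p Z -> mu (rep p `&` Z) = (weight p)%:E.
Proof.
move=> mZ /onE n; rewrite -mu_rep.
rewrite (measureDI mu (m_rep p) mZ) (measure_negligible _ n) ?add0e//.
by apply: measurableD => //; exact: m_rep.
Qed.

Lemma mk_atom A : fin_atom A ->
  {p : atom | forall Z, on p Z <-> mu.-negligible (A `\` Z)}.
Proof.
move=> aA; exists (exist _ (germ A) (ex_intro _ A (conj aA erefl))) => Z.
by [].
Qed.

Lemma weightE p A : fin_atom A ->
  (forall Z, on p Z <-> mu.-negligible (A `\` Z)) -> mu A = (weight p)%:E.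
Proof.
move=> [mA A0 Aoo Aat] E.
have pA : on p A by apply/E; rewrite setDv; exact: negligible_set0.
rewrite -(mu_on mA pA) setIC (measureDI mu mA (m_rep p)).
rewrite [X in (X + _)%E]measure_negligible ?add0e//.
  by apply: measurableD => //; exact: m_rep.
by apply/E; exact: on_rep.
Qed.

(** * Values of measurable functions on atoms, and Bessel's inequality *)

Section Values.

(** By the zero-one law each set [{a <= f}] is either full or null on the atom. The value is the
    supremum of the levels [a] with full set, and countable intersections over the tolerances
    [1/(n+1)] turn the approximate bounds into equality. *)
Lemma on_value p (f : X -> R) : measurable_fun setT f ->
  exists c, on p [set x | f x = c].
Proof.
move=> mf.
have mge a : measurable [set x | a <= f x].
  have := mf measurableT _ (measurable_itv `[a, +oo[).
  by rewrite setTI; congr measurable; apply/seteqP; split=> x /=; rewrite in_itv /= andbT.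
pose E : set R := [set a | on p [set x | a <= f x]].
have E0 : E !=set0.
  have [||n pn] := @on_bigcup nat p (fun n => [set x | - n%:R <= f x]) => //.
    apply: onS (onT p) => x _; exists (Num.bound (f x)) => //=.
    by rewrite lerNl ltW// unstable.ltrNbound.
  by exists (- n%:R).
have Eub n : ~ E (n%:R) -> ubound E n%:R.
  move=> nE a Ea; rewrite leNgt; apply/negP => na; apply: nE.
  by apply: onS Ea => x /=; apply: le_trans; exact: ltW.
have [n nEn] : exists n : nat, ~ E n%:R.
  apply: contrapT => /forallNP h.
  apply: (@not_on0 p); have /on_bigcap : forall n : nat, on p [set x | n%:R <= f x].
    by move=> n; exact: contrapT (h n).
  apply: onS => x /(_ (Num.bound (f x)) Logic.I) /=; rewrite leNgt => /negP; apply.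
  exact: unstable.ltr_bound.
have Es : has_sup E by split=> //; exists n%:R; exact: Eub.
exists (sup E).
have ge_sup : on p [set x | sup E <= f x].
  apply: (@onS _ (\bigcap_n [set x | sup E - n.+1%:R^-1 <= f x])).
    move=> x h /=; rewrite leNgt; apply/negP => lt.
    have := truncnS_gt (sup E - f x)^-1; set N := Num.trunc _ => hN.
    have := h N I => /=; rewrite lerBlDr -lerBlDl leNgt => /negP; apply.
    by rewrite invf_plt ?posrE ?subr_gt0.
  apply: on_bigcap => m.
  have [|a Ea lta] := @sup_adherent _ _ (m.+1%:R^-1) _ Es; first by rewrite invr_gt0.
  by apply: onS Ea => x /=; apply: le_trans; exact: ltW.
have le_sup : on p [set x | f x <= sup E].
  apply: (@onS _ (\bigcap_n [set x | f x < sup E + n.+1%:R^-1])).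
    move=> x h /=; rewrite leNgt; apply/negP => lt.
    have := truncnS_gt (f x - sup E)^-1; set N := Num.trunc _ => hN.
    have := h N I => /=; rewrite -ltrBlDl ltNge => /negP; apply; apply: ltW.
    by rewrite invf_plt ?posrE ?subr_gt0.
  apply: on_bigcap => m.
  have [Em|] := on_or p (mge (sup E + m.+1%:R^-1)).
    have /(sup_ubound Es.2) : E (sup E + m.+1%:R^-1) by [].
    by rewrite gerDl leNgt invr_gt0 ltr0n.
  by apply: onS => x /= /negP; rewrite -ltNge.
apply: onS (onI ge_sup le_sup) => x [/= a b].
by apply/eqP; rewrite eq_le a b.
Qed.

Implicit Types f g : X -> R[i].

Definition mfunC f := measurable_fun setT (fun x => complex.Re (f x)) /\
  measurable_fun setT (fun x => complex.Im (f x)).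

(* The almost everywhere constant value of [f] on the atom [p] ([0] if [f] is not
   almost everywhere constant on [p], e.g. not measurable). *)
Definition aval f p : R[i] := xget 0 [set c | on p [set x | f x = c]].

Lemma avalP f p c : on p [set x | f x = c] -> aval f p = c.
Proof.
move=> h; rewrite /aval; case: xgetP => [y -> /= hy|/(_ c) //].
by have [x [/= -> ->]] := on_both hy h.
Qed.

Lemma on_aval f p : mfunC f -> on p [set x | f x = aval f p].
Proof.
move=> [/(on_value p)[a pa] /(on_value p)[b pb]].
have h : on p [set x | f x = Complex a b].
  by apply: onS (onI pa pb) => x [/= <- <-]; case: (f x).
by rewrite (avalP h).
Qed.

Lemma aval_on f g p : mfunC f -> on p [set x | f x = g x] -> aval g p = aval f p.
Proof.
move=> mf fg; apply: avalP; apply: onS (onI fg (on_aval p mf)) => x [/=].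
by move=> -> ->.
Qed.

Lemma avalD f g p : mfunC f -> mfunC g ->
  aval (fun x => f x + g x) p = aval f p + aval g p.
Proof.
move=> mf mg; apply: avalP.
by apply: onS (onI (on_aval p mf) (on_aval p mg)) => x [/= -> ->].
Qed.

Lemma avalZ c f p : mfunC f -> aval (fun x => c * f x) p = c * aval f p.
Proof.
by move=> mf; apply: avalP; apply: onS (on_aval p mf) => x /= ->.
Qed.

Lemma mfunCD f g : mfunC f -> mfunC g -> mfunC (fun x => f x + g x).
Proof.
have ReD x : complex.Re (f x + g x) = complex.Re (f x) + complex.Re (g x).
  by case: (f x) (g x) => ? ? [].
have ImD x : complex.Im (f x + g x) = complex.Im (f x) + complex.Im (g x).
  by case: (f x) (g x) => ? ? [].
move=> [mf mf'] [mg mg']; split.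
  by under eq_fun do rewrite ReD; exact: measurable_funD.
by under eq_fun do rewrite ImD; exact: measurable_funD.
Qed.

Lemma mfunCM f g : mfunC f -> mfunC g -> mfunC (fun x => f x * g x).
Proof.
have ReM x : complex.Re (f x * g x) =
    complex.Re (f x) * complex.Re (g x) - complex.Im (f x) * complex.Im (g x).
  by case: (f x) (g x) => ? ? [].
have ImM x : complex.Im (f x * g x) =
    complex.Re (f x) * complex.Im (g x) + complex.Im (f x) * complex.Re (g x).
  by case: (f x) (g x) => ? ? [].
move=> [mf mf'] [mg mg']; split.
  by under eq_fun do rewrite ReM; apply: measurable_funB; exact: measurable_funM.
by under eq_fun do rewrite ImM; apply: measurable_funD; exact: measurable_funM.
Qed.

Lemma mfunC_cst (c : R[i]) : mfunC (fun _ => c).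
Proof. by split; exact: measurable_cst. Qed.

Lemma mfunCR (f : X -> R) : measurable_fun setT f -> mfunC (fun x => (f x)%:C%C).
Proof. by move=> mf; split => //=; exact: measurable_cst. Qed.

(** The domain [Y] is there for the induction: removing [rep (a i)] from it keeps all remaining
    atoms on it, since distinct atoms are disjoint up to null sets. *)
Lemma bessel (I : eqType) (s : seq I) (a : I -> atom) f Y : mfunC f ->
  uniq s -> {in s &, injective a} -> measurable Y ->
  (forall i, i \in s -> on (a i) Y) ->
  ((\sum_(i <- s) sqmod (aval f (a i)) * weight (a i))%:E <=
   \int[mu]_(x in Y) (sqmod (f x))%:E)%E.
Proof.
move=> mf; elim: s Y => [|i s IH] Y.
  move=> _ _ _ _; rewrite big_nil; apply: integral_ge0 => x _.
  by rewrite lee_fin sqmod_ge0.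
rewrite /= => /andP[nis us] ai mY Ys; rewrite big_cons EFinD.
have mr := m_rep (a i).
have mfE (D : set X) : measurable_fun D (fun x => (sqmod (f x))%:E).
  by apply/measurable_EFinP; apply: measurable_funTS; apply: measurable_sqmod; case: mf.
have mYD : measurable (Y `\` rep (a i)) by exact: measurableD.
have mYI : measurable (rep (a i) `&` Y) by exact: measurableI.
have YE : Y = (rep (a i) `&` Y) `|` (Y `\` rep (a i)).
  apply/seteqP; split=> [x Yx|x [[]|[]]//].
  by have [rx|nrx] := pselect (rep (a i) x); [left|right].
rewrite [X in integral _ X]YE ge0_integral_setU//; last 2 first.
- by move=> x _; rewrite lee_fin sqmod_ge0.
- by apply/disj_setPS => x [[rx _] [_ ]].
apply: leeD.
  have pY : on (a i) Y by apply: Ys; rewrite mem_head.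
  rewrite (ae_eq_integral (cst (sqmod (aval f (a i)))%:E))//.
    by rewrite integral_cst// mu_on// EFinM.
  have /onE := onI pY (on_aval (a i) mf).
  apply: negligibleS => x /= /not_implyP[[rx Yx] ne]; split=> // -[_ /= E].
  by apply: ne; rewrite E.
apply: IH => //.
- by move=> j k js ks; apply: ai; rewrite inE ?js ?ks orbT.
- move=> j js; apply: onI; first by apply: Ys; rewrite inE js orbT.
  apply: on_neq => E; have : j = i by apply: ai => //; rewrite inE ?js ?eqxx ?orbT.
  by move=> ji; rewrite -ji js in nis.
Qed.

End Values.
End Atoms.

(** * Square integrable functions *)

Section MeasurableExtra.
Context (R : realType) (d : measure_display) (X : measurableType d).

Lemma measurable_sqrtr : measurable_fun setT (@Num.sqrt R).
Proof.
have -> : @Num.sqrt R = fun x => if 0 < x then x `^ 2^-1 else 0.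
  apply/funext => x; case: ltP => [/ltW x0|x0]; first by rewrite powR12_sqrt.
  by rewrite ler0_sqrtr.
apply: measurable_fun_ifT => //.
exact: measurable_fun_ltr.
Qed.

Lemma measurable_invsqrtr : measurable_fun setT (fun x : R => (Num.sqrt x)^-1).
Proof.
have -> : (fun x : R => (Num.sqrt x)^-1) =
    fun x => if 0 < x then x `^ (- 2^-1) else 0.
  apply/funext => x; case: ltP => [/ltW x0|x0].
    by rewrite powRN powR12_sqrt.
  by rewrite ler0_sqrtr// invr0.
apply: measurable_fun_ifT => //.
exact: measurable_fun_ltr.
Qed.

Lemma measurable_ext0 (D : set X) (h : X -> R) : measurable D ->
  measurable_fun D h -> measurable_fun setT (fun x => if `[< D x >] then h x else 0).
Proof.
move=> mD /(measurable_restrictT h mD); exact.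
Qed.

Lemma measurable_fun_via (h : X -> R) (t : X -> X) (F D : set X) : measurable F ->
  (forall x, D x -> F (t x)) -> measurable_fun F h -> measurable_fun D t ->
  measurable_fun D (fun x => h (t x)).
Proof.
by move=> mF DF; apply: measurable_comp => // _ [x Dx <-]; exact: DF.
Qed.

End MeasurableExtra.

Section L2.
Context (R : realType) (d : measure_display) (X : measurableType d).
Variable mu : {measure set X -> \bar R}.
Implicit Types f g : X -> R[i].

Definition n2 f : \bar R := (\int[mu]_x (sqmod (f x))%:E)%E.

Lemma L2P f : L2set mu f <-> mfunC f /\ (n2 f < +oo)%E.
Proof. by split=> [[? ? ?]|[[? ?] ?]]; split. Qed.

Lemma L2_mfunC f : L2set mu f -> mfunC f.
Proof. by case/L2P. Qed.

Lemma measurable_sqmodE f (D : set X) : mfunC f ->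
  measurable_fun D (fun x => (sqmod (f x))%:E).
Proof.
move=> [mr mi]; apply/measurable_EFinP; apply: measurable_funTS.
exact: measurable_sqmod.
Qed.

Lemma n2_ge0 f : (0 <= n2 f)%E.
Proof. by apply: integral_ge0 => x _; rewrite lee_fin sqmod_ge0. Qed.

Lemma n2_fin f : L2set mu f -> n2 f = (fine (n2 f))%:E.
Proof. by move=> /L2P[_ ?]; rewrite fineK// ge0_fin_numE// n2_ge0. Qed.

Lemma fine_n2_ge0 f : 0 <= fine (n2 f).
Proof. by rewrite fine_ge0// n2_ge0. Qed.

Lemma n2_le f g : mfunC f -> mfunC g ->
  {ae mu, forall x, sqmod (f x) <= sqmod (g x)} -> (n2 f <= n2 g)%E.
Proof.
move=> mf mg h; apply: ae_ge0_le_integral => //.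
- by move=> x _; rewrite lee_fin sqmod_ge0.
- exact: measurable_sqmodE.
- by move=> x _; rewrite lee_fin sqmod_ge0.
- exact: measurable_sqmodE.
- by apply: filterS h => x + _; rewrite lee_fin.
Qed.

Lemma L2_le f g : mfunC f -> L2set mu g ->
  {ae mu, forall x, sqmod (f x) <= sqmod (g x)} -> L2set mu f.
Proof.
move=> mf /L2P[mg g2] h; apply/L2P; split=> //.
exact: le_lt_trans (n2_le mf mg h) g2.
Qed.

Lemma n2_ae f g : mfunC f -> mfunC g -> {ae mu, forall x, f x = g x} ->
  n2 f = n2 g.
Proof.
move=> mf mg h; apply/eqP; rewrite eq_le.
by rewrite !n2_le//; apply: filterS h => x ->.
Qed.

Lemma n2_0 : n2 (fun _ => 0) = 0%E.
Proof.
rewrite /n2 (_ : (fun _ => _) = cst 0%E) ?integral0//.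
by apply/funext => x; rewrite sqmod0.
Qed.

Lemma L2_0 : L2set mu (fun _ => 0).
Proof. by apply/L2P; split; [exact: mfunC_cst|rewrite n2_0]. Qed.

Lemma n2Z c f : mfunC f -> n2 (fun x => c * f x) = ((sqmod c)%:E * n2 f)%E.
Proof.
move=> mf; rewrite /n2; under eq_integral do rewrite sqmodM EFinM.
rewrite ge0_integralZl//; first exact: measurable_sqmodE.
- by move=> x _; rewrite lee_fin sqmod_ge0.
- by rewrite lee_fin sqmod_ge0.
Qed.

Lemma L2Z c f : L2set mu f -> L2set mu (fun x => c * f x).
Proof.
move=> f2; have mf := L2_mfunC f2; apply/L2P; split.
  by apply: mfunCM => //; exact: mfunC_cst.
by rewrite n2Z// n2_fin// -EFinM ltry.
Qed.

Lemma n2D f g : mfunC f -> mfunC g ->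
  (n2 (fun x => f x + g x)%R <= 2%:E * n2 f + 2%:E * n2 g)%E.
Proof.
move=> mf mg; rewrite -[leLHS]/(\int[mu]_x _)%E.
have s0 h x : (0 <= (sqmod (h x : R[i]))%:E :> \bar R)%E by rewrite lee_fin sqmod_ge0.
have s20 h x : (0 <= 2%:E * (sqmod (h x : R[i]))%:E :> \bar R)%E.
  by rewrite mule_ge0// lee_fin.
have m2 h : mfunC h ->
    measurable_fun [set: X] (fun x => 2%:E * (sqmod (h x : R[i]))%:E)%E.
  by move=> mh; apply: emeasurable_funM => //; exact: measurable_sqmodE.
have Z h : mfunC h -> (2%:E * n2 h)%E = (\int[mu]_x (2%:E * (sqmod (h x))%:E))%E.
  by move=> mh; rewrite ge0_integralZl//; exact: measurable_sqmodE.
rewrite (Z f mf) (Z g mg) -ge0_integralD//; [|exact: m2..].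
apply: ge0_le_integral => //.
- by apply: measurable_sqmodE; exact: mfunCD.
- by apply: emeasurable_funD; exact: m2.
- by move=> x _; rewrite -!EFinM -EFinD lee_fin sqmodD_le.
Qed.

Lemma L2D f g : L2set mu f -> L2set mu g -> L2set mu (fun x => f x + g x).
Proof.
move=> f2 g2; have mf := L2_mfunC f2; have mg := L2_mfunC g2.
apply/L2P; split; first exact: mfunCD.
apply: le_lt_trans (n2D mf mg) _.
by rewrite (n2_fin f2) (n2_fin g2) -!EFinM -EFinD ltry.
Qed.

Lemma subCE (f g : X -> R[i]) : (fun x => f x - g x) = (fun x => f x + (-1) * g x).
Proof. by apply/funext => x; rewrite mulN1r. Qed.

Lemma L2B f g : L2set mu f -> L2set mu g -> L2set mu (fun x => f x - g x).
Proof. by move=> f2 g2; rewrite subCE; apply: L2D => //; exact: L2Z. Qed.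

Lemma fine_n2D f g : L2set mu f -> L2set mu g ->
  fine (n2 (fun x => f x + g x)) <= 2 * fine (n2 f) + 2 * fine (n2 g).
Proof.
move=> f2 g2; have := n2D (L2_mfunC f2) (L2_mfunC g2).
by rewrite (n2_fin f2) (n2_fin g2) (n2_fin (L2D f2 g2)) -!EFinM -EFinD lee_fin.
Qed.

Lemma l2distE f g : l2dist mu f g = Num.sqrt (fine (n2 (fun x => f x - g x))).
Proof. by []. Qed.

Lemma l2dist_lt f g (e : R) : 0 < e ->
  (l2dist mu f g < e) = (fine (n2 (fun x => f x - g x)) < e ^+ 2).
Proof.
move=> e0; rewrite l2distE -[in LHS](gtr0_norm e0) -sqrtr_sqr ltr_sqrt//.
by rewrite exprn_gt0.
Qed.

(* The coordinate of [f] along the normalized indicator function of [p]; with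
   this normalization the Radon-Nikodym factors disappear from [fhat_op] and
   [fhat_adj]. *)
Definition fhat f (p : atom mu) : R[i] := (Num.sqrt (weight p))%:C%C * aval f p.

Lemma sqmod_fhat f p : sqmod (fhat f p) = sqmod (aval f p) * weight p.
Proof.
by rewrite /fhat sqmodM sqmodR sqr_sqrtr 1?mulrC// ltW// weight_gt0.
Qed.

Lemma bessel_fhat (I : eqType) (s : seq I) (a : I -> atom mu) f : L2set mu f ->
  uniq s -> {in s &, injective a} ->
  \sum_(i <- s) sqmod (fhat f (a i)) <= fine (n2 f).
Proof.
move=> f2 us ai; rewrite -lee_fin -n2_fin//.
under eq_bigr do rewrite sqmod_fhat.
apply: (@bessel _ _ _ mu _ s a f setT) => //; first exact: L2_mfunC.
by move=> i _; exact: onT.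
Qed.

Lemma sqmod_fhat_le f p : L2set mu f -> sqmod (fhat f p) <= fine (n2 f).
Proof.
move=> f2; have := @bessel_fhat nat [:: 0%N] (fun _ => p) f f2.
rewrite big_seq1; apply => // i j; rewrite !inE => /eqP -> /eqP -> //.
Qed.

Lemma fhatD f g p : mfunC f -> mfunC g ->
  fhat (fun x => f x + g x) p = fhat f p + fhat g p.
Proof. by move=> mf mg; rewrite /fhat avalD// mulrDr. Qed.

Lemma fhatZ c f p : mfunC f -> fhat (fun x => c * f x) p = c * fhat f p.
Proof. by move=> mf; rewrite /fhat avalZ// mulrCA. Qed.

Lemma fhat_ae f g p : mfunC f -> {ae mu, forall x, f x = g x} ->
  fhat g p = fhat f p.
Proof. by move=> mf fg; rewrite /fhat (aval_on mf)//; exact: on_ae. Qed.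

Lemma fhat_eq0 f p : mfunC f -> ae_zero mu f -> fhat f p = 0.
Proof.
by move=> mf f0; rewrite /fhat (@avalP _ _ _ mu f p 0) ?mulr0//; exact: on_ae.
Qed.

(** A bound uniform in [N] lets the condition [l i N f -> 0] pass to limits in [f]. Asking for
    convergence to [0] directly means that no limit functional has to be defined on the whole
    space. *)
Lemma closed_subspace_limits (I : Type) (D : set I) (l : I -> nat -> (X -> R[i]) -> R[i]) :
  (forall i N f g, mfunC f -> mfunC g ->
    l i N (fun x => f x + g x) = l i N f + l i N g) ->
  (forall i N c f, mfunC f -> l i N (fun x => c * f x) = c * l i N f) ->
  (forall i N f g, mfunC f -> {ae mu, forall x, f x = g x} -> l i N g = l i N f) ->
  (forall i, D i -> exists C : R, 0 < C /\ forall N f, L2set mu f ->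
     sqmod (l i N f) <= C * fine (n2 f)) ->
  closed_subspace mu [set f | L2set mu f /\ forall i, D i -> forall e : R, 0 < e ->
    exists N0, forall N, (N0 <= N)%N -> sqmod (l i N f) < e].
Proof.
move=> lD lZ lae lC.
have l0 i N : l i N (fun _ => 0) = 0.
  rewrite -[RHS](mul0r (l i N (fun _ => 0))) -lZ; last exact: mfunC_cst.
  by congr (l i N _); apply/funext => x; rewrite mul0r.
split; [split|].
- by move=> f [].
- split; first exact: L2_0.
  by move=> i _ e e0; exists 0%N => N _; rewrite l0 sqmod0.
- move=> f g [f2 hf] [g2 hg]; split; first exact: L2D.
  move=> i Di e e0; have e4 : 0 < e / 4 by rewrite divr_gt0.
  have [Nf hNf] := hf i Di _ e4; have [Ng hNg] := hg i Di _ e4.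
  exists (maxn Nf Ng) => N; rewrite geq_max => /andP[/hNf a /hNg b].
  rewrite lD; [|exact: L2_mfunC..].
  by apply: le_lt_trans (sqmodD_le _ _) _; lra.
- move=> c f [f2 hf]; split; first exact: L2Z.
  move=> i Di e e0; have c0 := sqmod_ge0 c.
  have c1 : 0 < sqmod c + 1 by rewrite ltr_wpDl.
  have [N0 hN] := hf i Di _ (divr_gt0 e0 c1).
  exists N0 => N /hN; rewrite lZ ?sqmodM; last exact: L2_mfunC.
  rewrite ltr_pdivlMr// mulrDr mulr1 mulrC; apply: le_lt_trans.
  by rewrite lerDl sqmod_ge0.
- move=> f g [f2 hf] g2 fg; split=> // i Di e e0.
  have [N0 hN] := hf i Di _ e0; exists N0 => N /hN.
  by rewrite (lae i N f g)//; exact: L2_mfunC.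
- move=> f f2 happ; split=> // i Di e e0.
  have [C [C0 hC]] := lC i Di.
  (* With [f - g] of squared norm below [e / (4 C)], both terms of [2 |l (f - g)|^2 + 2 |l g|^2]
     stay below [e / 2]. *)
  have t0 : 0 < e / (4 * C) by rewrite divr_gt0// mulr_gt0.
  have s0 : 0 < Num.sqrt (e / (4 * C)) by rewrite sqrtr_gt0.
  have [g [[g2 hg]]] := happ _ s0.
  rewrite l2dist_lt// sqr_sqrtr ?ltW// => hd.
  have [N0 hN] := hg i Di (e / 4) ltac:(by rewrite divr_gt0).
  exists N0 => N /hN hb.
  have fE : f = (fun x => (f x - g x) + g x) by apply/funext => x; rewrite subrK.
  have fg2 := L2B f2 g2.
  rewrite fE lD; [|exact: L2_mfunC..].
  apply: le_lt_trans (sqmodD_le _ _) _.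
  have := hC N _ fg2; move: hd; rewrite ltr_pdivlMr ?mulr_gt0//.
  by nra.
Qed.

End L2.

(** * The representation and its adjoint *)

Section Operators.
Context (k : nat) (L : kgraph k) (R : realType) (d : measure_display)
  (X : measurableType d) (mu : {measure set X -> \bar R}) (S : LSBFS L mu).
Implicit Types (l : kpath L) (f g : X -> R[i]).

Lemma stau_range l x : sD S l x -> sR S l (stau S l x).
Proof. by move=> Dx; exists x. Qed.

Lemma sR_code l x : sR S l x ->
  sD S l (scode S (kdeg l) x) /\ stau S l (scode S (kdeg l) x) = x.
Proof. by case=> y Dy <-; rewrite scode_tau. Qed.

Definition adj_op l f : X -> R[i] := fun x =>
  if `[< sD S l x >] then (Num.sqrt (sPhi S l x))%:C%C * f (stau S l x) else 0.

Lemma image_int l (G : X -> R) : measurable_fun setT G ->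
  (\int[mu]_(x in sR S l) (G x)%:E)%E =
  (\int[mu]_(x in sD S l) (G (stau S l x) * `|sPhi S l x|)%:E)%E.
Proof.
apply: integral_image.
- exact: sD_meas.
- exact: stau_meas.
- exact: sPhi_meas.
- exact: sPhi_pos.
- exact: sPhi_RN.
Qed.

Lemma image_negl l (A : set X) : A `<=` sD S l ->
  mu.-negligible (stau S l @` A) <-> mu.-negligible A.
Proof.
apply: (@image_negligible _ _ _ mu (sD S l) (stau S l) (sPhi S l)).
- exact: sD_meas.
- exact: stau_meas.
- exact: sPhi_meas.
- exact: sPhi_pos.
- exact: sPhi_RN.
Qed.

Lemma measurable_code f m : mfunC f -> mfunC (fun x => f (scode S m x)).
Proof.
move=> [mr mi]; split.
- exact: (measurableT_comp mr (scode_meas S m)).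
- exact: (measurableT_comp mi (scode_meas S m)).
Qed.

Lemma sbfs_opE l f : sbfs_op S l f = (fun x =>
  (if `[< sR S l x >] then (Num.sqrt (sPhi S l (scode S (kdeg l) x)))^-1
   else 0)%:C%C * f (scode S (kdeg l) x)).
Proof. by apply/funext => x; rewrite /sbfs_op; case: ifP => // _; rewrite mul0r. Qed.

Lemma mfunC_op l f : mfunC f -> mfunC (sbfs_op S l f).
Proof.
move=> mf; rewrite sbfs_opE; apply: mfunCM; last exact: measurable_code.
apply: mfunCR; apply: measurable_ext0; first exact: sR_meas.
have mP : measurable_fun (sR S l) (fun x => sPhi S l (scode S (kdeg l) x)).
  apply: (measurable_fun_via (F := sD S l)).
  - exact: sD_meas.
  - by move=> x /sR_code[].
  - exact: sPhi_meas.
  - by apply: measurable_funTS; exact: scode_meas.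
exact: (measurableT_comp (@measurable_invsqrtr R) mP).
Qed.

Lemma mfunC_adj l f : mfunC f -> mfunC (adj_op l f).
Proof.
have mD := sD_meas S l.
have ms : measurable_fun (sD S l) (fun x => Num.sqrt (sPhi S l x)).
  exact: (measurableT_comp (@measurable_sqrtr R) (@sPhi_meas _ _ _ _ _ _ S l)).
move=> [mr mi]; split.
  have -> : (fun x => complex.Re (adj_op l f x)) = (fun x =>
      if `[< sD S l x >] then Num.sqrt (sPhi S l x) * complex.Re (f (stau S l x))
      else 0).
    apply/funext => x; rewrite /adj_op; case: ifP => // _.
    by case: (f _) => a b /=; rewrite mul0r subr0.
  apply: measurable_ext0 => //; apply: measurable_funM => //.
  by apply: (measurable_fun_via (F := setT)) mr _ => //; exact: stau_meas.
have -> : (fun x => complex.Im (adj_op l f x)) = (fun x =>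
    if `[< sD S l x >] then Num.sqrt (sPhi S l x) * complex.Im (f (stau S l x))
    else 0).
  apply/funext => x; rewrite /adj_op; case: ifP => // _.
  by case: (f _) => a b /=; rewrite mul0r addr0.
apply: measurable_ext0 => //; apply: measurable_funM => //.
by apply: (measurable_fun_via (F := setT)) mi _ => //; exact: stau_meas.
Qed.

Lemma integral_supp (D : set X) (h : X -> R) : (forall x, ~ D x -> h x = 0) ->
  (\int[mu]_x (h x)%:E)%E = (\int[mu]_(x in D) (h x)%:E)%E.
Proof.
move=> h0; rewrite [RHS]integral_mkcond; apply: eq_integral => x _.
rewrite patchE; case: ifPn => //; rewrite notin_setE => /h0 -> //.
Qed.

Lemma op_off l f x : ~ sR S l x -> sbfs_op S l f x = 0.
Proof. by move=> nR; rewrite /sbfs_op asboolF. Qed.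

Lemma adj_off l f x : ~ sD S l x -> adj_op l f x = 0.
Proof. by move=> nD; rewrite /adj_op asboolF. Qed.

Lemma op_tau l f x : sD S l x ->
  sbfs_op S l f (stau S l x) = ((Num.sqrt (sPhi S l x))^-1)%:C%C * f x.
Proof.
by move=> Dx; rewrite /sbfs_op asboolT ?scode_tau//; exact: stau_range.
Qed.

Lemma n2_op l f : mfunC f ->
  n2 mu (sbfs_op S l f) = (\int[mu]_(x in sD S l) (sqmod (f x))%:E)%E.
Proof.
move=> mf; have mo := mfunC_op l mf.
rewrite /n2 (integral_supp (D := sR S l)); last first.
  by move=> x nR; rewrite op_off// sqmod0.
rewrite image_int; last by apply: measurable_sqmod; case: mo.
have mD := sD_meas S l.
apply: ae_eq_integral => //.
- apply/measurable_EFinP; apply: measurable_funM; last first.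
    by apply: measurableT_comp => //; exact: sPhi_meas.
  apply: (measurable_fun_via (F := setT) (h := fun x => sqmod (sbfs_op S l f x))) => //.
    by apply: measurable_sqmod; case: mo.
  exact: stau_meas.
- exact: measurable_sqmodE.
apply: filterS (sPhi_pos S l) => x P Dx; congr EFin; have P0 := P Dx.
rewrite op_tau// sqmodM sqmodR exprVn sqr_sqrtr ?ltW// gtr0_norm//.
by rewrite mulrAC mulVf ?mul1r ?gt_eqF.
Qed.

Lemma n2_adj l f : mfunC f ->
  n2 mu (adj_op l f) = (\int[mu]_(x in sR S l) (sqmod (f x))%:E)%E.
Proof.
move=> mf; have ma := mfunC_adj l mf.
rewrite /n2 (integral_supp (D := sD S l)); last first.
  by move=> x nR; rewrite adj_off// sqmod0.
rewrite image_int; last by apply: measurable_sqmod; case: mf.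
have mD := sD_meas S l.
apply: ae_eq_integral => //.
- exact: measurable_sqmodE.
- apply/measurable_EFinP; apply: measurable_funM; last first.
    by apply: measurableT_comp => //; exact: sPhi_meas.
  apply: (measurable_fun_via (F := setT) (h := fun x => sqmod (f x))) => //.
    by apply: measurable_sqmod; case: mf.
  exact: stau_meas.
apply: filterS (sPhi_pos S l) => x P Dx; congr EFin; have P0 := P Dx.
rewrite /adj_op asboolT// sqmodM sqmodR sqr_sqrtr ?ltW// gtr0_norm//.
by rewrite mulrC.
Qed.

Lemma n2_sub f (D : set X) : mfunC f -> measurable D ->
  (\int[mu]_(x in D) (sqmod (f x))%:E <= n2 mu f)%E.
Proof.
move=> mf mD; apply: ge0_subset_integral => //; first exact: measurable_sqmodE.
by move=> x _; rewrite lee_fin sqmod_ge0.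
Qed.

Lemma L2_op l f : L2set mu f -> L2set mu (sbfs_op S l f).
Proof.
move=> /L2P[mf f2]; apply/L2P; split; first exact: mfunC_op.
by rewrite n2_op//; apply: le_lt_trans f2; apply: n2_sub => //; exact: sD_meas.
Qed.

Lemma L2_adj l f : L2set mu f -> L2set mu (adj_op l f).
Proof.
move=> /L2P[mf f2]; apply/L2P; split; first exact: mfunC_adj.
by rewrite n2_adj//; apply: le_lt_trans f2; apply: n2_sub => //; exact: sR_meas.
Qed.

Lemma mfunC_conj f : mfunC f -> mfunC (fun x => conjc (f x)).
Proof.
move=> [mr mi]; split.
  have -> : (fun x => complex.Re (conjc (f x))) = (fun x => complex.Re (f x)).
    by apply/funext => x; case: (f x).
  exact: mr.
have -> : (fun x => complex.Im (conjc (f x))) = (fun x => - complex.Im (f x)).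
  by apply/funext => x; case: (f x).
exact: measurableT_comp.
Qed.

(** Pulling the integral over [R_l] back to [D_l] introduces the density [Phi], and
    [Phi^(-1/2) Phi = Phi^(1/2)] is the factor in [adj_op]. *)
Lemma adj_opP l f : L2set mu f -> is_adj_image mu (sbfs_op S l) f (adj_op l f).
Proof.
move=> f2; split; first exact: L2_adj.
move=> g g2; rewrite /inner /Rintegral.
have mf := L2_mfunC f2; have mg := L2_mfunC g2.
have mD := sD_meas S l.
have mo := mfunC_op l mg.
have ma := mfunC_adj l mf.
have mL := mfunCM mo (mfunC_conj mf).
have mR := mfunCM mg (mfunC_conj ma).
(* [P] stands for the real or the imaginary part; only its homogeneity over the reals enters the
   computation. *)
suff H (P : R[i] -> R) : (forall a b z, P (a%:C%C * b%:C%C * z) = a * b * P z) ->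
    P 0 = 0 ->
    measurable_fun setT (fun x => P (sbfs_op S l g x * conjc (f x))) ->
    measurable_fun setT (fun x => P (g x * conjc (adj_op l f x))) ->
    (\int[mu]_x (P (sbfs_op S l g x * conjc (f x)))%:E =
     \int[mu]_x (P (g x * conjc (adj_op l f x)))%:E)%E.
  congr Complex; congr fine; apply: H => //; try by [case: mL|case: mR].
  - by move=> a b [u v] /=; ring.
  - by move=> a b [u v] /=; ring.
move=> PM P0 mPL mPR.
rewrite (integral_supp (D := sR S l)); last first.
  by move=> x nR; rewrite op_off// mul0r.
rewrite [RHS](integral_supp (D := sD S l)); last first.
  by move=> x nR; rewrite adj_off// conjc0 mulr0.
rewrite image_int//; apply: ae_eq_integral => //.
- apply/measurable_EFinP; apply: measurable_funM; last first.
    by apply: measurableT_comp => //; exact: sPhi_meas.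
  apply: (measurable_fun_via (F := setT)
    (h := fun x => P (sbfs_op S l g x * conjc (f x)))) => //.
  exact: stau_meas.
- by apply/measurable_EFinP; apply: measurable_funTS.
apply: filterS (sPhi_pos S l) => x Pos Dx; congr EFin; have Phi0 := Pos Dx.
rewrite op_tau// /adj_op asboolT// rmorphM/=.
set s := Num.sqrt _; set z := conjc (f _).
have s0 : s != 0 by rewrite gt_eqF// sqrtr_gt0.
have -> : `|sPhi S l x| = s ^+ 2 by rewrite gtr0_norm// sqr_sqrtr// ltW.
have -> : s^-1%:C%C * g x * z = s^-1%:C%C * 1%:C%C * (g x * z) by rewrite mulr1 mulrA.
have -> : g x * (conjc s%:C%C * z) = s%:C%C * 1%:C%C * (g x * z).
  rewrite mulr1 mulrCA; congr (_ * _).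
  by rewrite /= oppr0.
rewrite !PM !mulr1 mulrAC; congr (_ * _).
by rewrite expr2 mulrA mulVf// mul1r.
Qed.

Lemma op_adj l f : {ae mu, forall x,
  sbfs_op S l (adj_op l f) x = if `[< sR S l x >] then f x else 0}.
Proof.
(* The two sides can differ only on the image under [stau] of this null set, where the square root
   of [Phi] may vanish; the image is null as well. *)
pose N := [set x | sD S l x /\ ~ 0 < sPhi S l x].
have ND : N `<=` sD S l by move=> x [].
have : mu.-negligible N.
  by apply: negligibleS (sPhi_pos S l) => x [Dx n] /= /(_ Dx).
move=> /(image_negl ND).
apply: negligibleS => x /= neq.
have [Rx|nR] := pselect (sR S l x); last by case: neq; rewrite op_off// asboolF.
have [Dy yx] := sR_code Rx.
exists (scode S (kdeg l) x) => //; split => // Phi0; apply: neq.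
rewrite -{1}yx op_tau// /adj_op !asboolT// yx mulrA -rmorphM/= mulVf ?mul1r//.
by rewrite gt_eqF// sqrtr_gt0.
Qed.

End Operators.

(** * Shifts on atoms *)

Section Dynamics.
Context (k : nat) (L : kgraph k) (R : realType) (d : measure_display)
  (X : measurableType d) (mu : {measure set X -> \bar R}) (S : LSBFS L mu).
Implicit Types (l : kpath L) (f g : X -> R[i]) (p q : atom mu)
  (m n : 'I_k -> nat).

Lemma m_sR l : measurable (sR S l).
Proof. exact: sR_meas. Qed.

Lemma m_sD l : measurable (sD S l).
Proof. exact: sD_meas. Qed.

Lemma label_ex p m : exists l, kdeg l = m /\ on p (sR S l).
Proof.
pose F l := if `[< kdeg l = m >] then sR S l else set0.
have mF l : measurable (F l).
  by rewrite /F; case: ifP => // _; exact: m_sR.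
have E : \bigcup_(l in [set l | kdeg l = m]) sR S l = \bigcup_l F l.
  apply/seteqP; split=> x [l lm Rx]; exists l => //.
    by rewrite /F asboolT.
    by move: Rx; rewrite /F; case: asboolP.
  by move: Rx; rewrite /F; case: asboolP.
have [l] : exists l, on p (F l).
  apply: on_bigcup => //.
  have : on p (~` ~` \bigcup_(l in [set l | kdeg l = m]) sR S l).
    apply: on_null; apply/negligibleP; last exact: sR_cover.
    by apply: measurableC; rewrite E; exact: countable_bigcupT_measurable.
  by rewrite setCK E.
rewrite /F; case: asboolP => [lm pl|_ /not_on0//].
by exists l.
Qed.

Lemma label_uniq p l l' : kdeg l = kdeg l' -> on p (sR S l) -> on p (sR S l') ->
  l = l'.
Proof.
move=> ll' pl pl'; apply: contrapT => ne.
have /on_both : on p (~` (sR S l `&` sR S l')).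
  apply: on_null; apply/negligibleP; last exact: sR_disj.
  by apply: measurableI; exact: m_sR.
by move=> /(_ _ (onI pl pl'))[x []].
Qed.

Lemma sR_id v : sR S (kid v) = sD S (kid v).
Proof.
apply/seteqP; split=> [_ [y Dy <-]|y Dy]; first by rewrite stau_vert.
by exists y => //; rewrite stau_vert.
Qed.

Lemma on_sub p (Y Z : set X) : measurable Y -> measurable Z ->
  mu (Y `\` Z) = 0%E -> on p Y -> on p Z.
Proof.
move=> mY mZ YZ0 pY.
have pn : on p (~` (Y `\` Z)).
  by apply: on_null; apply/negligibleP => //; exact: measurableD.
apply: onS (onI pY pn) => x [Yx nYZ].
by apply: contrapT => nZ; apply: nYZ.
Qed.

(** Since [l = l id], the axiom on domains of compositions identifies [D_l] with the domain of its
    source vertex up to null sets. Lying in a domain thus becomes a condition on the infinite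
    path. *)
Lemma on_sD p l : on p (sD S l) <-> on p (sR S (kid (ks l))).
Proof.
have e : ks l = kr (kid (ks l)) by rewrite kr_id.
have [h1 h2] := scomp_dom S e; rewrite kcomp_idr in h1 h2.
rewrite sR_id; split; apply: on_sub => //; exact: m_sD.
Qed.

(** The image of the part of [rep p] inside [D_l] is again an atom because [stau] preserves null
    sets in both directions; its measure is the integral of [Phi], which is constant on [p]. *)
Lemma tau_atom p l : on p (sD S l) -> exists q,
  (forall Z, on q Z <-> on p (stau S l @^-1` Z)) /\
  (forall c, on p [set x | sPhi S l x = c] -> weight q = c * weight p).
Proof.
move=> pD; have mD := m_sD l; have mA := m_rep p.
pose A' := rep p `&` sD S l.
have mA' : measurable A' by exact: measurableI.
have A'D : A' `<=` sD S l by move=> x [].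
have pA' : on p A' by apply: onI => //; exact: on_rep.
have [mB muB] := sPhi_RN mA' A'D.
have onp Y : Y `<=` sD S l -> on p Y <-> mu.-negligible (A' `\` Y).
  move=> YD; split=> [/onE|n].
    by apply: negligibleS => x [[]].
  apply/onE; have /onE n2 := pA'.
  apply: negligibleS (negligibleU n n2) => x [rx nY].
  by have [a|a] := pselect (A' x); [left|right].
have imD Y : stau S l @` (A' `\` stau S l @^-1` Y) = stau S l @` A' `\` Y.
  apply/seteqP; split=> [_ [x [A'x nY] <-]|_ [[x A'x <-] nY]].
    by split => //; exists x.
  by exists x.
have onpre Y : on p (stau S l @^-1` Y) <-> mu.-negligible (stau S l @` A' `\` Y).
  rewrite -imD image_negl; last by move=> x [/A'D].
  split=> [pY|n].
    have /onE := onI pY (on_rep p).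
    by apply: negligibleS => x [[rx Dx] nY]; split => // -[/nY].
  have : on p (sD S l `&` stau S l @^-1` Y).
    apply/onp; first by move=> x [].
    apply: negligibleS n => x [A'x nY]; split => // Yx; apply: nY.
    by split => //; exact: A'D.
  by apply: onS => x [].
have aB : fin_atom mu (stau S l @` A').
  split=> //.
  - rewrite lt0e measure_ge0 andbT; apply/eqP => /(negligibleP _ mB).
    move/(image_negl A'D) => n; have := on_null p n.
    by move=> /(on_both pA')[x []].
  - apply: le_lt_trans (sR_fin S l); apply: le_measure; rewrite ?inE//.
      exact: m_sR.
    by move=> _ [x /A'D Dx <-]; exists x.
  - move=> C mC CB.
    have mDC : measurable (sD S l `&` stau S l @^-1` C) by exact: stau_meas.
    have [pC|pnC] := on_or p mDC.
      right; apply: measure_negligible; first exact: measurableD.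
      by apply/onpre; apply: onS pC => x [].
    left; apply: measure_negligible => //.
    have : on p (stau S l @^-1` (~` C)).
      by apply: onS (onI pnC pD) => x [nDC Dx] /= Cx; apply: nDC.
    move/onpre; rewrite setDE setCK; apply: negligibleS => x Cx.
    by split => //; exact: CB.
have [q qE] := mk_atom aB; exists q; split.
  by move=> Z; rewrite qE onpre.
move=> c pc; have := weightE aB qE; rewrite muB => E.
apply: EFin_inj; rewrite -E EFinM -(mu_on mD pD) -/A'.
rewrite (ae_eq_integral (cst c%:E)) ?integral_cst//.
  by apply/measurable_EFinP; exact: (measurable_funS mD A'D (@sPhi_meas _ _ _ _ _ _ S l)).
have /onE := onI pc (on_rep p); apply: negligibleS => x /= /not_implyP[A'x ne].
by split; [case: A'x|move=> [/= e _]; apply: ne; rewrite e].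
Qed.

Lemma sig_atom p m : exists q, forall Z, on q Z <-> on p (scode S m @^-1` Z).
Proof.
have [l [lm pl]] := label_ex p m; rewrite -lm {lm m}.
have mA := m_rep p; have mR := m_sR l.
pose A1 := rep p `&` sR S l.
have pA1 : on p A1 by apply: onI => //; exact: on_rep.
have mA1 : measurable A1 by exact: measurableI.
(* This is the image of [A1] under the coding map, written as a preimage under [stau] so that it is
   measurable. *)
pose B := sD S l `&` stau S l @^-1` A1.
have mB : measurable B by apply: stau_meas => //; exact: m_sD.
have BD : B `<=` sD S l by move=> x [].
have imB Z : stau S l @` (B `\` Z) = A1 `\` scode S (kdeg l) @^-1` Z.
  apply/seteqP; split=> [_ [x [[Dx A1x] nZ] <-]|x [A1x nZ]].
    by split => //=; rewrite scode_tau.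
  have [Dx tx] := sR_code A1x.2.
  exists (scode S (kdeg l) x) => //; split => //; split => //=.
  by rewrite tx.
have onE1 Z : on p Z <-> mu.-negligible (A1 `\` Z).
  split=> [/onE|n]; first by apply: negligibleS => x [[]].
  apply/onE; have /onE n2 := pA1.
  apply: negligibleS (negligibleU n n2) => x [rx nY].
  by have [a|a] := pselect (A1 x); [left|right].
have onB Z : on p (scode S (kdeg l) @^-1` Z) <-> mu.-negligible (B `\` Z).
  by rewrite onE1 -imB; apply: image_negl => x [/BD].
have aB : fin_atom mu B.
  split=> //.
  - rewrite lt0e measure_ge0 andbT; apply/eqP => /(negligibleP _ mB) n.
    have : on p (scode S (kdeg l) @^-1` set0) by apply/onB; rewrite setD0.
    by rewrite preimage_set0; exact: not_on0.
  - apply: le_lt_trans (sD_fin S l); apply: le_measure; rewrite ?inE//.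
    exact: m_sD.
  - move=> C mC CB.
    have mSC : measurable (scode S (kdeg l) @^-1` C).
      by rewrite -[X in measurable X]setTI; exact: scode_meas.
    have [pC|pnC] := on_or p mSC.
      right; apply: measure_negligible; first exact: measurableD.
      exact/onB.
    left; apply: measure_negligible => //.
    have : on p (scode S (kdeg l) @^-1` (~` C)) by [].
    move/onB; rewrite setDE setCK; apply: negligibleS => x Cx.
    by split => //; exact: CB.
have [q qE] := mk_atom aB; exists q => Z.
by rewrite qE -onB.
Qed.

(* The coding maps [sig m] and the prefixing maps [tau l] on atoms; [tau l p] is
   meaningful only if [p] lies in D_l, and is [p] otherwise. *)
Definition sig m p : atom mu := sval (cid (sig_atom p m)).

Definition tau l p : atom mu :=
  if pselect (on p (sD S l)) is left h then sval (cid (tau_atom h)) else p.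

Lemma on_sig m p Z : on (sig m p) Z <-> on p (scode S m @^-1` Z).
Proof. by rewrite /sig; case: cid. Qed.

Lemma on_tau l p Z : on p (sD S l) ->
  on (tau l p) Z <-> on p (stau S l @^-1` Z).
Proof. by rewrite /tau; case: pselect => // h _; case: cid => q [qE qw] /=. Qed.

Lemma weight_tau l p c : on p (sD S l) -> on p [set x | sPhi S l x = c] ->
  weight (tau l p) = c * weight p.
Proof.
by rewrite /tau; case: pselect => // h _; case: cid => q [qE qw] /=; exact: qw.
Qed.

Lemma sigD m n p : sig m (sig n p) = sig (degadd m n) p.
Proof.
apply: atom_ext => Z; rewrite !on_sig.
have -> // : scode S n @^-1` (scode S m @^-1` Z) = scode S (degadd m n) @^-1` Z.
by apply/seteqP; split=> x /=; rewrite scode_add.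
Qed.

Lemma degaddC m n : degadd m n = degadd n m.
Proof. by apply/funext => i; rewrite /degadd addnC. Qed.

Lemma degaddA m n o : degadd m (degadd n o) = degadd (degadd m n) o.
Proof. by apply/funext => i; rewrite /degadd addnA. Qed.

Lemma sigC m n p : sig m (sig n p) = sig n (sig m p).
Proof. by rewrite !sigD degaddC. Qed.

Lemma on_sigD l p : on p (sR S l) -> on (sig (kdeg l) p) (sD S l).
Proof. by move=> pl; apply/on_sig; apply: onS pl => x /sR_code[]. Qed.

Lemma tau_sig l p : on p (sR S l) -> tau l (sig (kdeg l) p) = p.
Proof.
move=> pl; apply: on_ext => Z mZ.
rewrite (on_tau _ (on_sigD pl)) on_sig => h; apply: onS (onI pl h) => x [].
by move=> /sR_code[_] /= ->.
Qed.

Lemma on_tauR l p : on p (sD S l) -> on (tau l p) (sR S l).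
Proof. by move=> pD; apply/(on_tau _ pD); apply: onS pD => x; exact: stau_range. Qed.

Lemma sig_tau l p : on p (sD S l) -> sig (kdeg l) (tau l p) = p.
Proof.
move=> pD; apply: on_ext => Z mZ; rewrite on_sig (on_tau _ pD) => h.
by apply: onS (onI pD h) => x [Dx] /=; rewrite scode_tau.
Qed.

Lemma tau_comp l l' p : ks l = kr l' -> on p (sD S l') ->
  [/\ on (tau l' p) (sD S l), on p (sD S (Defs.kcomp l l')) &
      tau l (tau l' p) = tau (Defs.kcomp l l') p].
Proof.
move=> e pD'.
have tD : on (tau l' p) (sD S l).
  apply: on_sub (on_tauR pD'); [exact: m_sR|exact: m_sD|].
  exact: sR_sub.
have pD : on p (sD S (Defs.kcomp l l')).
  apply: on_sub pD'; [exact: m_sD|exact: m_sD|].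
  by have [] := scomp_dom S e.
split => //; apply: on_ext => Z mZ /(on_tau _ tD)/(on_tau _ pD') h.
apply/(on_tau _ pD); have pe := on_ae p (scomp S e).
by apply: onS (onI pD' (onI h pe)) => x [Dx [/= Zx /(_ Dx) <-]].
Qed.

Lemma on_sR_comp l l' p : ks l = kr l' ->
  on p (sR S (Defs.kcomp l l')) <-> on p (sR S l) /\ on (sig (kdeg l) p) (sR S l').
Proof.
move=> e; split=> [pR|[pl pl']].
  have qD := on_sigD pR; set q := sig _ p in qD.
  have qD' : on q (sD S l').
    apply: on_sub qD; [exact: m_sD|exact: m_sD|].
    by have [] := scomp_dom S e.
  have [tD _ tE] := tau_comp e qD'.
  have pE : p = tau l (tau l' q) by rewrite tE tau_sig.
  by rewrite pE sig_tau//; split; exact: on_tauR.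
have qD' := on_sigD pl'; have [tD qD tE] := tau_comp e qD'.
by rewrite -(tau_sig pl) -[X in tau l X](tau_sig pl') tE; exact: on_tauR.
Qed.

(** The atom lies in the vertex sets of both [ks l] and [kr l'], and its label of degree zero is
    unique. *)
Lemma on_source p l l' : on p (sD S l) -> on p (sR S l') -> ks l = kr l'.
Proof.
move=> /on_sD pD pR.
have : on p (sR S (kid (kr l'))).
  have := pR; rewrite -{1}(kcomp_idl l') on_sR_comp; first by case.
  by rewrite ks_id.
move=> /(label_uniq _ pD); rewrite !kdeg_id => /(_ erefl) E.
by rewrite -(kr_id (ks l)) E kr_id.
Qed.

(* [p] and [q] have the same infinite path. *)
Definition same p q := forall l, on p (sR S l) <-> on q (sR S l).

Lemma same_sym p q : same p q -> same q p.
Proof. by move=> h l; split; apply h. Qed.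

Lemma same_trans q p r : same p q -> same q r -> same p r.
Proof. by move=> h h' l; split=> [/h/h'|/h'/h]. Qed.

(** One inclusion suffices because every atom has exactly one label of each degree. *)
Lemma same_sub p q : (forall l, on p (sR S l) -> on q (sR S l)) -> same p q.
Proof.
move=> h l; split; first exact: h.
have [l' [e pl']] := label_ex p (kdeg l) => ql.
by rewrite -(label_uniq e (h _ pl') ql).
Qed.

Lemma same_sD p q l : same p q -> on p (sD S l) -> on q (sD S l).
Proof. by move=> h /on_sD/h/on_sD. Qed.

Lemma same_sig m p q : same p q -> same (sig m p) (sig m q).
Proof.
move=> h; apply: same_sub => l'.
have [l [<- pl]] := label_ex p m => sl'.
have e := on_source (on_sigD pl) sl'.
have /h : on p (sR S (Defs.kcomp l l')) by apply/(on_sR_comp _ e).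
by move/(on_sR_comp _ e) => [].
Qed.

Lemma same_tau l p q : same p q -> on p (sD S l) -> same (tau l p) (tau l q).
Proof.
move=> h pD; have qD := same_sD h pD; apply: same_sub => l1 tl1.
have [b [bE pb]] := label_ex p (kdeg l1).
have e := on_source pD pb.
have tpb r : on r (sD S l) -> on r (sR S b) -> on (tau l r) (sR S (Defs.kcomp l b)).
  move=> rD rb; apply/(on_sR_comp _ e); split; first exact: on_tauR.
  by rewrite sig_tau.
(* Both [tau l p] and [tau l q] carry the label [l b]. Its initial segment of the degree of [l1] is
   therefore a label of both, and for [tau l p] it must be [l1]. *)
have /kfact [[c c'] [/=[e' cE _ lbE] _]] :
    kdeg (Defs.kcomp l b) = degadd (kdeg l1) (kdeg l).
  by rewrite kdeg_comp// bE degaddC.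
have := tpb _ pD pb; rewrite lbE => /(on_sR_comp _ e')[pc _].
rewrite -(label_uniq cE pc tl1).
by have /h/(tpb _ qD) := pb; rewrite lbE => /(on_sR_comp _ e')[].
Qed.

(** An atom is recovered from its shift by prefixing its label of degree [m], which is the same for
    [p] and [q]. *)
Lemma same_sig_inj m p q : same p q -> sig m p = sig m q -> p = q.
Proof.
move=> h; have [l [<- pl]] := label_ex p m => E.
by rewrite -(tau_sig pl) E tau_sig//; apply/h.
Qed.

Definition tail p q := exists m n, sig m p = sig n q.

Lemma tail_sig p q m : tail p q -> tail (sig m p) q.
Proof.
move=> [a [b E]]; exists a; exists (degadd m b).
by rewrite sigC E sigD.
Qed.

Lemma tail_tau p q l : on p (sD S l) -> tail p q -> tail (tau l p) q.
Proof.
move=> pD [a [b E]]; exists (degadd a (kdeg l)); exists b.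
by rewrite -sigD sig_tau.
Qed.

(* [q] arises from [p] by replacing an initial segment of degree [a + c] by one of
   degree [b + c] of the common infinite path. *)
Definition shift (a b : 'I_k -> nat) p q :=
  same p q /\ exists c, sig (degadd b c) q = sig (degadd a c) p.

Lemma shift_sym a b p q : shift a b p q -> shift b a q p.
Proof. by move=> [h [c E]]; split; [exact: same_sym|exists c]. Qed.

(** The degrees [c] in the two hypotheses may differ; after shifting to a common degree, injectivity
    on atoms with the same path applies. *)
Lemma shift_uniq a b p q q' : shift a b p q -> shift a b p q' -> q = q'.
Proof.
move=> [h [c E]] [h' [c' E']].
apply: (@same_sig_inj (degadd c' (degadd b c))).
  exact: same_trans (same_sym h) h'.
rewrite -sigD E sigD.
have -> : degadd c' (degadd b c) = degadd c (degadd b c').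
  by rewrite degaddC -degaddA [RHS]degaddC -degaddA (degaddC c).
rewrite -[RHS]sigD E' sigD.
by rewrite degaddC -degaddA [in RHS]degaddC -degaddA (degaddC c).
Qed.

Lemma shift_sig a b m p q : shift a b p q -> shift a b (sig m p) (sig m q).
Proof.
move=> [h [c E]]; split; first exact: same_sig.
by exists c; rewrite sigC E sigC.
Qed.

(** If [r] joins [p] after degree [m], then the shifts of [r] by [a + m] and by [b + m] have the
    same path, inherited from [sig a p = sig b q]. Prefixing the first with the label of [r] of
    degree [b + m] gives an atom with the path of [r]. *)
Lemma shift_ex a b p q r : same p q -> sig a p = sig b q -> tail r p ->
  exists r', shift a b r r'.
Proof.
move=> h E [m [n E']].
have [l [lE rl]] := label_ex r (degadd b m).
have s1 : same (sig (degadd a m) r) (sig (degadd b m) r).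
  rewrite -!sigD E' (sigC a n p) E (sigC b n p).
  by do 2 apply: same_sig; exact: same_sym.
have rD := on_sigD rl; rewrite lE in rD.
have sD1 := same_sD (same_sym s1) rD.
exists (tau l (sig (degadd a m) r)); split.
  apply: same_sym; rewrite -[X in same _ X](tau_sig rl) lE.
  exact: same_tau.
by exists m; rewrite -lE sig_tau.
Qed.

(** Preserving paths and commuting with the coding maps forces compatibility with the prefixing
    maps; so composing coordinates with [u] commutes with the operators [pi(s_l)] and their
    adjoints. *)
Definition symmetry (u : atom mu -> atom mu) :=
  (forall p, same p (u p)) /\ (forall m p, u (sig m p) = sig m (u p)).

Lemma symmetry_tau u l p : symmetry u -> on p (sD S l) ->
  u (tau l p) = tau l (u p).
Proof.
move=> [us usig] pD.
have [/(_ (on_tauR pD)) uR _] := us (tau l p) l.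
by rewrite -[LHS](tau_sig uR) -usig sig_tau.
Qed.

(** By existence and uniqueness [shift a b] is the graph of a map, whose inverse has graph
    [shift b a]; uniqueness also makes it commute with the coding maps. *)
Lemma shift_symmetry a b p q : same p q -> sig a p = sig b q ->
  (forall r, tail r p) -> exists u v, [/\ symmetry u, symmetry v, u p = q,
    cancel u v & cancel v u].
Proof.
move=> h E allt.
have /choice[u uE] : forall r, exists r', shift a b r r'.
  by move=> r; exact: (shift_ex h E (allt r)).
have /choice[v vE] : forall r, exists r', shift b a r r'.
  move=> r; apply: (shift_ex (same_sym h) (esym E)).
  have [m [n e]] := allt r; exists (degadd a m), (degadd n b).
  by rewrite -!sigD e sigC E.
exists u, v; split.
- by split=> [r|m r]; [case: (uE r)|apply: shift_uniq (uE _) (shift_sig _ (uE _))].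
- by split=> [r|m r]; [case: (vE r)|apply: shift_uniq (vE _) (shift_sig _ (vE _))].
- apply: shift_uniq (uE p) _; split => //; exists a.
  by rewrite degaddC -sigD -E sigD.
- by move=> r; apply: shift_uniq (vE _) _; apply: shift_sym; exact: uE.
- by move=> r; apply: shift_uniq (uE _) _; apply: shift_sym; exact: vE.
Qed.

Lemma Phi_value l p : on p (sD S l) ->
  exists c, 0 < c /\ on p [set x | sPhi S l x = c].
Proof.
move=> pD.
have [c pc] := on_value p (measurable_ext0 (m_sD l) (@sPhi_meas _ _ _ _ _ _ S l)).
have pc' : on p [set x | sPhi S l x = c].
  by apply: onS (onI pD pc) => x [Dx /=]; rewrite asboolT.
exists c; split=> //.
have [x [Dx [/= Pc P]]] := on_both pD (onI pc' (on_ae p (sPhi_pos S l))).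
by rewrite -Pc; exact: P.
Qed.

Lemma fhat_op l f p : mfunC f ->
  fhat (sbfs_op S l f) p =
  if `[< on p (sR S l) >] then fhat f (sig (kdeg l) p) else 0.
Proof.
move=> mf; case: asboolP => [pl|npl]; last first.
  have [//|pn] := on_or p (m_sR l).
  rewrite /fhat (@avalP _ _ _ _ _ p 0) ?mulr0//.
  by apply: onS pn => x nR /=; rewrite op_off.
have qD := on_sigD pl; set q := sig _ p in qD *.
have pE : p = tau l q by rewrite tau_sig.
have [c [c0 qc]] := Phi_value qD.
have wE := weight_tau qD qc; rewrite -pE in wE.
rewrite /fhat (@avalP _ _ _ _ _ p ((Num.sqrt c)^-1%:C%C * aval f q)); last first.
  rewrite pE on_tau//.
  apply: onS (onI qD (onI qc (on_aval q mf))) => x [Dx [/= Pc fx]].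
  by rewrite op_tau// Pc fx.
rewrite mulrA -rmorphM/= wE sqrtrM ?ltW// mulrAC mulfV ?mul1r//.
by rewrite gt_eqF// sqrtr_gt0.
Qed.

Lemma fhat_adj l f p : mfunC f ->
  fhat (adj_op S l f) p = if `[< on p (sD S l) >] then fhat f (tau l p) else 0.
Proof.
move=> mf; case: asboolP => [pD|npD]; last first.
  have [//|pn] := on_or p (m_sD l).
  rewrite /fhat (@avalP _ _ _ _ _ p 0) ?mulr0//.
  by apply: onS pn => x nR /=; rewrite adj_off.
have [c [c0 pc]] := Phi_value pD.
have wE := weight_tau pD pc.
rewrite /fhat (@avalP _ _ _ _ _ p ((Num.sqrt c)%:C%C * aval f (tau l p))); last first.
  have h := on_aval (tau l p) mf; rewrite on_tau// in h.
  apply: onS (onI pD (onI pc h)) => x [Dx [/= Pc fx]].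
  by rewrite /adj_op asboolT// Pc fx.
by rewrite mulrA -rmorphM/= wE sqrtrM ?ltW// [Num.sqrt c * _]mulrC.
Qed.

End Dynamics.

(** * Consequences of irreducibility *)

Section StepFunctions.
Context (R : realType) (d : measure_display) (X : measurableType d).
Variable mu : {measure set X -> \bar R}.
Implicit Types (f : X -> R[i]) (Z : set X) (p q : atom mu).

Definition rst Z f : X -> R[i] := fun x => if `[< Z x >] then f x else 0.

Lemma rstT Z f x : Z x -> rst Z f x = f x.
Proof. by move=> Zx; rewrite /rst asboolT. Qed.

Lemma rstF Z f x : ~ Z x -> rst Z f x = 0.
Proof. by move=> nZ; rewrite /rst asboolF. Qed.

Lemma mfunC_rst Z f : measurable Z -> mfunC f -> mfunC (rst Z f).
Proof.
move=> mZ [mr mi]; split.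
  have -> : (fun x => complex.Re (rst Z f x)) =
      (fun x => if `[< Z x >] then complex.Re (f x) else 0).
    by apply/funext => x; rewrite /rst; case: ifP.
  by apply: measurable_ext0 => //; exact: measurable_funTS.
have -> : (fun x => complex.Im (rst Z f x)) =
    (fun x => if `[< Z x >] then complex.Im (f x) else 0).
  by apply/funext => x; rewrite /rst; case: ifP.
by apply: measurable_ext0 => //; exact: measurable_funTS.
Qed.

Lemma L2_rst Z f : measurable Z -> L2set mu f -> L2set mu (rst Z f).
Proof.
move=> mZ f2; have mf := L2_mfunC f2.
apply: (L2_le _ f2); first exact: mfunC_rst.
apply: aeW => x; rewrite /rst; case: ifP => // _.
by rewrite sqmod0 sqmod_ge0.
Qed.

Lemma n2_rst Z f : n2 mu (rst Z f) = (\int[mu]_(x in Z) (sqmod (f x))%:E)%E.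
Proof.
rewrite /n2 (integral_supp mu (D := Z)); last first.
  by move=> x nZ; rewrite /rst asboolF// sqmod0.
by apply: eq_integral => x; rewrite inE => Zx; rewrite /rst asboolT.
Qed.

Definition ind Z : X -> R[i] := rst Z (fun _ => 1).

Lemma indT Z x : Z x -> ind Z x = 1.
Proof. exact: rstT. Qed.

Lemma indF Z x : ~ Z x -> ind Z x = 0.
Proof. exact: rstF. Qed.

Lemma n2_ind Z : measurable Z -> n2 mu (ind Z) = mu Z.
Proof.
move=> mZ; rewrite /ind n2_rst; under eq_integral do rewrite -[1]/(1%:C%C) sqmodR expr1n.
by rewrite integral_cst// mul1e.
Qed.

Lemma L2_ind Z : measurable Z -> (mu Z < +oo)%E -> L2set mu (ind Z).
Proof.
move=> mZ fZ; apply/L2P; split; last by rewrite n2_ind.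
by apply: mfunC_rst => //; exact: mfunC_cst.
Qed.

Lemma fhat_rst_on Z f p : mfunC f -> on p Z -> fhat (rst Z f) p = fhat f p.
Proof.
move=> mf pZ; rewrite /fhat (aval_on mf)//.
by apply: onS pZ => x Zx /=; rewrite /rst asboolT.
Qed.

Lemma fhat_rst_off Z f p : on p (~` Z) -> fhat (rst Z f) p = 0.
Proof.
move=> pZ; rewrite /fhat (@avalP _ _ _ _ _ p 0) ?mulr0//.
by apply: onS pZ => x nZ /=; rewrite /rst asboolF.
Qed.

Lemma fhat_ind_on Z p : on p Z -> fhat (ind Z) p = (Num.sqrt (weight p))%:C%C.
Proof.
move=> pZ; rewrite fhat_rst_on//.
rewrite /fhat (@avalP _ _ _ _ _ p 1) ?mulr1//.
exact: onS (onT p).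
Qed.

Lemma sqrt_weight_neq0 p : (Num.sqrt (weight p))%:C%C != 0 :> R[i].
Proof.
apply/eqP => /(congr1 (@complex.Re R)) /= /eqP.
by apply/negP; rewrite gt_eqF// sqrtr_gt0 weight_gt0.
Qed.

Lemma L2_rep p : L2set mu (ind (rep p)).
Proof. by apply: L2_ind; [exact: m_rep|rewrite mu_rep ltry]. Qed.

Variable B : nat -> set X.

Definition stepf (c : nat -> R[i]) : X -> R[i] := fun x =>
  if pselect (exists n, B n x) is left h then c (sval (cid h)) else 0.

Lemma stepf_off c x : (forall n, ~ B n x) -> stepf c x = 0.
Proof. by rewrite /stepf => h; case: pselect => // -[n Bn]; case: (h n Bn). Qed.

Hypotheses (mB : forall n, measurable (B n)) (tB : trivIset setT B).

Lemma stepf_on c n x : B n x -> stepf c x = c n.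
Proof.
move=> Bn; rewrite /stepf; case: pselect => [h|[]]; last by exists n.
case: cid => m Bm /=; congr c; apply: (tB (i := m) (j := n)) => //.
by exists x.
Qed.

Lemma measurable_stepf (g : X -> R) (a : nat -> R) :
  (forall n x, B n x -> g x = a n) -> (forall x, (forall n, ~ B n x) -> g x = 0) ->
  measurable_fun setT g.
Proof.
move=> gB g0 _ Y mY; rewrite setTI.
have -> : g @^-1` Y = (\bigcup_n (B n `&` [set x | Y (a n)])) `|`
    ((~` \bigcup_n B n) `&` [set x | Y 0]).
  apply/seteqP; split=> [x Yx|x].
    have [[n Bn]|nB] := pselect (exists n, B n x).
      by left; exists n => //; split => //=; rewrite -(gB n x).
    right; split; first by move=> [n _ Bn]; apply: nB; exists n.
    by rewrite /= -(g0 x) // => n Bn; apply: nB; exists n.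
  move=> [[n _ [Bn Ya]]|[nB Y0]]; first by rewrite /= (gB n x).
  by rewrite /= g0// => n Bn; apply: nB; exists n.
have mc (Q : Prop) : measurable [set x : X | Q].
  have [q|nq] := pselect Q.
    by rewrite (_ : [set x | Q] = setT)//; apply/seteqP; split.
  by rewrite (_ : [set x | Q] = set0)//; apply/seteqP; split.
apply: measurableU.
  by apply: bigcupT_measurable => n; exact: measurableI.
by apply: measurableI => //; apply: measurableC; exact: bigcupT_measurable.
Qed.

Lemma mfunC_stepf c : mfunC (stepf c).
Proof.
split.
  apply: (measurable_stepf (a := fun n => complex.Re (c n))).
    by move=> n x Bn; rewrite (stepf_on c Bn).
  by move=> x nB; rewrite stepf_off.
apply: (measurable_stepf (a := fun n => complex.Im (c n))).
  by move=> n x Bn; rewrite (stepf_on c Bn).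
by move=> x nB; rewrite stepf_off.
Qed.

Lemma L2_stepf c (M : R) : (forall n,
  (\sum_(0 <= i < n) (sqmod (c i))%:E * mu (B i) <= M%:E)%E) ->
  L2set mu (stepf c).
Proof.
move=> hM; have mf := mfunC_stepf c; apply/L2P; split=> //.
rewrite /n2 (integral_supp mu (D := \bigcup_n B n)); last first.
  by move=> x nB; rewrite stepf_off ?sqmod0// => n Bn; apply: nB; exists n.
rewrite ge0_integral_bigcup//; last 2 first.
- exact: measurable_sqmodE.
- by move=> x _; rewrite lee_fin sqmod_ge0.
apply: (@le_lt_trans _ _ M%:E); last exact: ltry.
apply: lime_le; first by apply: is_cvg_nneseries => n _ _;
  apply: integral_ge0 => x _; rewrite lee_fin sqmod_ge0.
apply: nearW => n; apply: le_trans (hM n); rewrite le_eqVlt; apply/orP; left.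
apply/eqP; apply: eq_bigr => i _.
rewrite (eq_integral (cst (sqmod (c i))%:E)) ?integral_cst//.
by move=> x; rewrite inE => Bx; rewrite /= (stepf_on c Bx).
Qed.

End StepFunctions.
Arguments ind {R d X} Z _.

Section Irreducible.
Context (k : nat) (L : kgraph k) (R : realType) (d : measure_display)
  (X : measurableType d) (mu : {measure set X -> \bar R}) (S : LSBFS L mu).
Implicit Types (l : kpath L) (f g : X -> R[i]) (p q : atom mu)
  (m : 'I_k -> nat).
Hypothesis irr : sbfs_irreducible S.

Section Invariant.
Variables (D : set (atom mu)) (n : nat -> nat) (H : nat -> nat -> R[i])
  (u : nat -> nat -> atom mu -> atom mu).

(** Letting length, coefficients and maps depend on [N] covers evaluation at an atom, the difference
    along a symmetry, and the partial sums of a series over an orbit. *)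
Definition ell N f p := \sum_(0 <= i < n N) H N i * fhat f (u N i p).

Definition ell_kernel := [set f | L2set mu f /\ forall p, D p ->
  forall e : R, 0 < e -> exists N0, forall N, (N0 <= N)%N ->
    sqmod (ell N f p) < e].

(** Symmetries keep labels and commute with shifts, so [ell N] of [pi(s_l) f] at [p] is either [0]
    or [ell N f] at the shifted atom, and likewise for the adjoint with the prefixed atom. Since [D]
    is stable under both moves, the kernel is invariant. *)
Lemma ell_dichotomy :
  (forall p m, D p -> D (sig S m p)) ->
  (forall p l, on p (sD S l) -> D p -> D (tau S l p)) ->
  (forall N i, symmetry S (u N i)) ->
  (forall p, D p -> exists C : R, 0 < C /\ forall N f, L2set mu f ->
    sqmod (ell N f p) <= C * fine (n2 mu f)) ->
  ell_kernel `<=` ae_zero mu \/ L2set mu `<=` ell_kernel.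
Proof.
move=> Dsig Dtau usym Dbnd; apply: irr.
- apply: (closed_subspace_limits (l := fun p N f => ell N f p)) => //.
  + move=> p N f g mf mg; rewrite /ell -big_split; apply: eq_bigr => i _.
    by rewrite fhatD// mulrDr.
  + move=> p N c f mf; rewrite /ell mulr_sumr; apply: eq_bigr => i _.
    by rewrite fhatZ// mulrCA.
  + move=> p N f g mf fg; rewrite /ell; apply: eq_bigr => i _.
    by rewrite (fhat_ae _ mf fg).
- move=> l f [f2 Vf]; have mf := L2_mfunC f2; split; first exact: L2_op.
  move=> p Dp e e0; have [pl|npl] := pselect (on p (sR S l)).
    have [N0 hN] := Vf _ (Dsig p (kdeg l) Dp) e e0.
    exists N0 => N /hN; congr (sqmod _ < _); apply: eq_bigr => i _.
    have [us usig] := usym N i.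
    have [/(_ pl) ul _] := us p l.
    by rewrite fhat_op// asboolT// usig.
  exists 0%N => N _; rewrite /ell big1 ?sqmod0// => i _.
  have [us usig] := usym N i.
  rewrite fhat_op// asboolF ?mulr0// => h; apply: npl.
  by have [_ /(_ h)] := us p l.
- move=> l f [f2 Vf]; have mf := L2_mfunC f2.
  exists (adj_op S l f); split; last exact: adj_opP.
  split; first exact: L2_adj.
  move=> p Dp e e0; have [pl|npl] := pselect (on p (sD S l)).
    have [N0 hN] := Vf _ (Dtau p l pl Dp) e e0.
    exists N0 => N /hN; congr (sqmod _ < _); apply: eq_bigr => i _.
    have [us usig] := usym N i.
    rewrite (symmetry_tau (usym N i) pl) fhat_adj// asboolT//.
    exact: same_sD pl.
  exists 0%N => N _; rewrite /ell big1 ?sqmod0// => i _.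
  have [us usig] := usym N i.
  rewrite fhat_adj// asboolF ?mulr0// => h; apply: npl.
  exact: same_sD (same_sym (us p)) h.
Qed.

End Invariant.

(** The kernel for plain evaluation on the tail class of [a] misses the indicator function of [a],
    so it is zero. This also excludes any part of [X] without atoms. *)
Lemma fhat_tail_eq0 (a : atom mu) f : L2set mu f ->
  (forall p, tail S p a -> fhat f p = 0) -> ae_zero mu f.
Proof.
move=> f2 f0.
pose D := [set p | tail S p a].
have ellE N g p : ell (fun _ => 1%N) (fun _ _ => 1) (fun _ _ => id) N g p = fhat g p.
  by rewrite /ell big_nat1 mul1r.
case: (@ell_dichotomy D (fun _ => 1%N) (fun _ _ => 1) (fun _ _ => id)).
- by move=> p m; exact: tail_sig.
- by move=> p l; exact: tail_tau.
- by move=> _ _; split.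
- move=> p _; exists 1; split => // N g g2; rewrite ellE mul1r.
  exact: sqmod_fhat_le.
- apply; split=> // p Dp e e0; exists 0%N => N _.
  by rewrite ellE f0// sqmod0.
- move=> /(_ _ (L2_rep a))[_ /(_ a)].
  have ta : D a by exists (fun _ => 0%N), (fun _ => 0%N).
  move=> /(_ ta (weight a) (weight_gt0 a))[N0 /(_ _ (leqnn N0))].
  rewrite ellE fhat_ind_on; last exact: on_rep.
  by rewrite sqmodR sqr_sqrtr ?ltxx// ltW// weight_gt0.
Qed.

Lemma all_tail p q : tail S p q.
Proof.
apply: contrapT => npq.
have /(fhat_eq0 (f := ind (rep p)) p) : ae_zero mu (ind (rep p)).
  apply: (@fhat_tail_eq0 q); first exact: L2_rep.
  move=> r rq; apply: fhat_rst_off; apply: on_neq => E.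
  by apply: npq; rewrite -E.
move=> /(_ (L2_mfunC (L2_rep p))) /eqP.
by rewrite fhat_ind_on ?(negbTE (sqrt_weight_neq0 p))//; exact: on_rep.
Qed.

Lemma vertex_cover : mu.-negligible (~` \bigcup_(v : kvert L) sR S (kid v)).
Proof.
have := sR_cover S (fun _ => 0%N) => h0.
exists (~` \bigcup_(l in [set l | kdeg l = (fun _ => 0%N)]) (stau S l @` sD S l)).
have E : \bigcup_(l in [set l | kdeg l = (fun _ => 0%N)]) (stau S l @` sD S l) =
    \bigcup_(v : kvert L) sR S (kid v).
  apply/seteqP; split=> x [l].
    move=> /= l0 Rx; exists (kr l) => //.
    suff -> : kid (kr l) = l by [].
    have z (i : 'I_k) : degadd (fun _ : 'I_k => 0%N) (fun _ => 0%N) i = 0%N by [].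
    have ld : kdeg l = degadd (fun _ => 0%N) (fun _ => 0%N) by rewrite l0; exact/funext.
    have [[a b] [_ uniq]] := kfact ld.
    (* A path of degree zero factors both as [id l] and as [l id]; unique factorization makes it an
       identity. *)
    have h1 : (a, b) = (kid (kr l), l).
      by apply: uniq; split => //=; rewrite ?ks_id ?kdeg_id ?kcomp_idl.
    have h2 : (a, b) = (l, kid (ks l)).
      by apply: uniq; split => //=; rewrite ?kr_id ?kdeg_id ?kcomp_idr.
    by move: h1; rewrite h2 => -[].
  by move=> _ Rx; exists (kid l) => //=; rewrite kdeg_id.
rewrite E; split => //; last by rewrite -E.
by apply: measurableC; apply: countable_bigcupT_measurable => // v; exact: m_sR.
Qed.

Lemma negligible_countable (I : countType) (F : I -> set X) :
  (forall i, mu.-negligible (F i)) -> mu.-negligible (\bigcup_i F i).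
Proof.
move=> h.
pose G n := if unpickle n is Some i then F i else set0.
apply: (@negligibleS _ _ _ _ (\bigcup_n G n)).
  by move=> x [i _ Fx]; exists (pickle i) => //; rewrite /G pickleK.
apply: negligible_bigcup => n; rewrite /G; case: unpickle => [i|].
  exact: h.
exact: negligible_set0.
Qed.

(** [Z] may have infinite measure, so it is cut by the countably many vertex sets of finite measure;
    the indicator function of each piece has only zero coordinates. *)
Lemma no_atom_negligible (a : atom mu) (Z : set X) : measurable Z ->
  (forall p, ~ on p Z) -> mu.-negligible Z.
Proof.
move=> mZ nZ.
apply: (@negligibleS _ _ _ _ (\bigcup_(v : kvert L) (Z `&` sR S (kid v)) `|`
    ~` \bigcup_(v : kvert L) sR S (kid v))).
  move=> x Zx; have [[v _ Rx]|nR] := pselect ((\bigcup_(v : kvert L) sR S (kid v)) x).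
    by left; exists v.
  by right.
apply: negligibleU; last exact: vertex_cover.
apply: negligible_countable => v; set W := Z `&` _.
have mW : measurable W by apply: measurableI => //; exact: m_sR.
have fW : (mu W < +oo)%E.
  apply: le_lt_trans (sR_fin S (kid v)); apply: le_measure; rewrite ?inE//.
  exact: m_sR.
  by move=> x [].
have : ae_zero mu (ind W).
  apply: (@fhat_tail_eq0 a); first exact: L2_ind.
  move=> p _; apply: fhat_rst_off; have [|//] := on_or p mW.
  by move=> pW; case: (nZ p); apply: onS pW => x [].
apply: negligibleS => x Wx /=; rewrite /ind /rst asboolT// => /eqP.
by rewrite oner_eq0.
Qed.

End Irreducible.

(** * A sequence orthogonal to its reflected translates *)

Section Convolution.
Context (R : realType).

(* 0, 1, -1, 2, -2, ... *)
Definition zenum (i : nat) : int := if odd i then (i./2.+1)%:Z else - (i./2)%:Z.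

Lemma zenum_odd j : zenum j.*2.+1 = j.+1%:Z.
Proof. by rewrite /zenum /= odd_double /= uphalf_double. Qed.

Lemma zenum_even j : zenum j.*2 = - j%:Z.
Proof. by rewrite /zenum odd_double doubleK. Qed.

Lemma zenum_inj : injective zenum.
Proof.
move=> i j; rewrite -(odd_double_half i) -(odd_double_half j).
case: (odd i); case: (odd j); rewrite ?add0n ?add1n ?zenum_odd ?zenum_even => E; lia.
Qed.

Lemma zenum_surj (j : int) : exists i, zenum i = j.
Proof.
case: j => [[|n]|n]; first by exists 0%N.
  by exists n.*2.+1; rewrite zenum_odd.
by exists n.+1.*2; rewrite zenum_even NegzE.
Qed.

(** The symmetric sum over [-N <= z <= N]: these integers are the first [2 N + 1] values of [zenum].
    Symmetry makes odd functions sum to zero exactly. *)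
Definition zsum (V : nmodType) (F : int -> V) N := \sum_(0 <= i < N.*2.+1) F (zenum i).

Lemma zsum0 (V : nmodType) (F : int -> V) : zsum F 0 = F 0.
Proof. by rewrite /zsum big_nat1. Qed.

Lemma zsumS (V : nmodType) (F : int -> V) N :
  zsum F N.+1 = zsum F N + F N.+1%:Z + F (- N.+1%:Z).
Proof.
rewrite /zsum doubleS !big_nat_recr //= -[N.*2.+2]/(N.+1.*2).
by rewrite zenum_odd !zenum_even.
Qed.

Lemma zsumD (V : nmodType) (F G : int -> V) N :
  zsum (fun z => F z + G z) N = zsum F N + zsum G N.
Proof. exact: big_split. Qed.

Lemma zsum_shift (V : zmodType) (F : int -> V) N :
  zsum (fun z => F (z + 1)) N = zsum F N + F N.+1%:Z - F (- N%:Z).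
Proof.
elim: N => [|N IH]; first by rewrite !zsum0 oppr0 add0r addrC addKr.
rewrite !zsumS IH.
have -> : - N.+1%:Z + 1 = - N%:Z by lia.
have -> : N.+1%:Z + 1 = N.+2%:Z by lia.
by rewrite addrAC addrNK [in RHS]addrAC addrK.
Qed.

Lemma zsum_delta (V : nmodType) (F : int -> V) (t : int) N : (`|t| <= N)%N ->
  zsum (fun z => if z == t then F z else 0) N = F t.
Proof.
elim: N => [|N IH].
  by rewrite leqn0 absz_eq0 => /eqP ->; rewrite zsum0 eqxx.
rewrite leq_eqVlt ltnS => /orP[/eqP tN|tN].
  rewrite zsumS /zsum big_nat big1 => [|i iN]; last first.
    case: eqP => // E; exfalso; move: iN tN; rewrite -E.
    rewrite -(odd_double_half i); case: (odd i);
      by rewrite ?add0n ?add1n ?zenum_odd ?zenum_even; lia.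
  have [->|->] : t = N.+1%:Z \/ t = - N.+1%:Z by lia.
    have -> : (- N.+1%:Z == N.+1%:Z) = false by lia.
    by rewrite eqxx addr0 add0r.
  have -> : (N.+1%:Z == - N.+1%:Z) = false by lia.
  by rewrite eqxx !add0r.
rewrite zsumS IH//.
have -> : (N.+1%:Z == t) = false by lia.
have -> : (- N.+1%:Z == t) = false by lia.
by rewrite !addr0.
Qed.

(** Up to a constant factor, the Fourier coefficients of nonzero index of the indicator function of
    a half circle. *)
Definition oddinv (z : int) : R := if odd `|z| then (z%:~R)^-1 else 0.

Lemma oddD (z j : int) : odd `|z + j| = odd `|z| (+) odd `|j|.
Proof. lia. Qed.

Lemma oddinvN z : oddinv (- z) = - oddinv z.
Proof. by rewrite /oddinv abszN; case: ifP; rewrite ?oppr0// mulrNz invrN. Qed.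

Lemma zsum_oddinv N : zsum oddinv N = 0.
Proof.
elim: N => [|N IH]; first by rewrite zsum0.
by rewrite zsumS IH oddinvN add0r subrr.
Qed.

Lemma oddinv_nat (n : nat) : `|oddinv n%:Z| <= n%:R^-1.
Proof.
rewrite /oddinv; case: ifP => _; last by rewrite normr0.
by rewrite normfV -pmulrn normr_nat.
Qed.

Lemma cvg_oddinv (j : int) : oddinv (N%:Z + j) @[N --> \oo] --> (0 : R).
Proof.
rewrite -(cvg_shiftn `|j|.+1).
apply/norm_cvg0P.
apply: (@squeeze_cvgr _ _ _ _ (fun=> 0) (@harmonic R)).
- near=> N; rewrite normr_ge0 /=.
  have [n nE] : exists n : nat, (N + `|j|.+1)%:Z + j = (N + n).+1%:Z.
    by exists (absz (`|j|%:Z + j)); lia.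
  rewrite nE; apply: le_trans (oddinv_nat _) _.
  by rewrite /harmonic /= lef_pV2 ?posrE// ler_nat ltnS leq_addr.
- exact: cvg_cst.
- exact: cvg_harmonic.
Unshelve. all: by end_near. Qed.

(** For [j = 0] the sums vanish by oddness, and changing [j] by one alters them only by two end
    terms, which tend to zero. *)
Lemma cvg_zsum_oddinv (j : int) :
  zsum (fun z => oddinv (z + j)) N @[N --> \oo] --> (0 : R).
Proof.
have step (i : int) : (fun N => zsum (fun z => oddinv (z + (i + 1))) N) =
    (fun N => zsum (fun z => oddinv (z + i)) N +
      oddinv (N%:Z + (i + 1)) + oddinv (N%:Z - i)).
  apply/funext => N.
  apply: etrans (_ : _ = zsum (fun z => oddinv (z + 1 + i)) N) _.
    by apply: eq_bigr => z _; congr oddinv; lia.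
  apply: etrans (zsum_shift (fun z => oddinv (z + i)) N) _.
  rewrite -!addrA; congr (_ + _); rewrite -[X in _ + X]oddinvN.
  by congr (oddinv _ + oddinv _); lia.
have up i : zsum (fun z => oddinv (z + i)) N @[N --> \oo] --> (0 : R) <->
    zsum (fun z => oddinv (z + (i + 1))) N @[N --> \oo] --> (0 : R).
  pose w N := oddinv (N%:Z + (i + 1)) + oddinv (N%:Z - i).
  have c0 : w N @[N --> \oo] --> (0 : R).
    by rewrite -[X in _ --> X](addr0 0); apply: cvgD; exact: cvg_oddinv.
  pose v N := zsum (fun z => oddinv (z + i)) N.
  rewrite step (_ : (fun N => _ + _ + _) = (fun N => v N + w N)); last first.
    by apply/funext => N; rewrite -addrA.
  split => h; first by rewrite -[X in _ --> X](addr0 0); apply: cvgD.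
  have {}h := cvgB h c0; rewrite subr0 in h.
  rewrite (_ : (fun N => _) = (fun N => v N + w N - w N)); first exact: h.
  by apply/funext => N; rewrite addrK.
elim: j => [|n|n].
- rewrite (_ : (fun N => _) = fun=> 0); first exact: cvg_cst.
  apply/funext => N; rewrite -[RHS](zsum_oddinv N); congr (zsum _ N).
  by apply/funext => z; rewrite addr0.
- move=> h; have -> : n.+1%:Z = n%:Z + 1 by lia.
  by apply/(up n%:Z).
- move=> h; apply/up; rewrite (_ : - n.+1%:Z + 1 = - n%:Z)//; lia.
Unshelve. all: by end_near. Qed.

(** Partial fractions for even [j]; for odd [j] one of [z] and [z + j] is even. *)
Lemma oddinvM (j : int) (z : int) : j != 0 ->
  oddinv z * oddinv (z + j) =
  if odd `|j| then 0 else j%:~R^-1 * (oddinv z - oddinv (z + j)).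
Proof.
move=> j0; rewrite /oddinv oddD.
case oj: (odd `|j|); case oz: (odd `|z|) => //=; rewrite ?mulr0 ?mul0r ?subr0 ?mulr0//.
have z0 : z%:~R != 0 :> R by rewrite intr_eq0; lia.
have zj0 : (z + j)%:~R != 0 :> R by rewrite intr_eq0; lia.
have {}j0 : j%:~R != 0 :> R by rewrite intr_eq0.
rewrite intrD in zj0 *; field.
by rewrite z0 j0 zj0.
Qed.

Lemma cvg_zsum_corr (j : int) : j != 0 ->
  zsum (fun z => oddinv z * oddinv (z + j)) N @[N --> \oo] --> (0 : R).
Proof.
move=> j0; case oj: (odd `|j|).
  rewrite (_ : (fun N => _) = fun=> 0); first exact: cvg_cst.
  by apply/funext => N; rewrite /zsum big1// => i _; rewrite oddinvM// oj.
rewrite (_ : (fun N => _) = fun N => (- j%:~R^-1) * zsum (fun z => oddinv (z + j)) N).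
  by rewrite -[X in _ --> X](mulr0 (- j%:~R^-1)); apply: cvgMr; exact: cvg_zsum_oddinv.
apply/funext => N; rewrite -[RHS]add0r -(mulr0 j%:~R^-1) -(zsum_oddinv N).
rewrite /zsum !mulr_sumr -big_split; apply: eq_bigr => i _ /=.
by rewrite oddinvM// oj mulrBr mulNr.
Qed.

(** The bound telescopes: the two new terms contribute at most
    [2 / (N+1)^2 <= 4 / (N+1) - 4 / (N+2)]. *)
Lemma zsum_sqr_le N : zsum (fun z => oddinv z ^+ 2) N <= 4 - 4 / N.+1%:R.
Proof.
elim: N => [|N IH].
  by rewrite zsum0 /oddinv /= expr0n divr1 subrr.
rewrite zsumS oddinvN sqrrN.
have : oddinv N.+1%:Z ^+ 2 <= N.+1%:R^-1 ^+ 2.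
  by rewrite -(real_normK (num_real (oddinv _))) lerXn2r ?nnegrE// oddinv_nat.
have E : 4 / N.+1%:R - 4 / N.+2%:R - 2 * (N.+1%:R^-1 ^+ 2) =
   2 * (N%:R) / (N.+1%:R ^+ 2 * N.+2%:R) :> R.
  rewrite -[N.+2]addn1 -[N.+1]addn1 !natrD; field.
  by have n0 : 0 <= N%:R :> R by []; rewrite !gt_eqF//; lra.
have : 0 <= 2 * (N%:R) / (N.+1%:R ^+ 2 * N.+2%:R) :> R.
  by rewrite divr_ge0// mulr_ge0// exprn_ge0.
rewrite -E; set x := N.+1%:R^-1; set y := N.+2%:R^-1; set o := oddinv _ ^+ 2.
move: IH; rewrite -/x; move: (zsum _ N) x y o => v x y o h1 h2 h3; lra.
Qed.

Lemma zsum_sqr_cvg : exists s : R, [/\ 0 < s,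
  zsum (fun z => oddinv z ^+ 2) N @[N --> \oo] --> s &
  forall N, zsum (fun z => oddinv z ^+ 2) N <= s].
Proof.
pose v N := zsum (fun z => oddinv z ^+ 2) N.
have nd : nondecreasing_seq v.
  apply/nondecreasing_seqP => N; rewrite /v zsumS -addrA lerDl.
  by rewrite addr_ge0 ?sqr_ge0.
have cv : cvgn v.
  apply: nondecreasing_is_cvgn => //; exists 4 => _ [N _ <-].
  by apply: le_trans (zsum_sqr_le N) _; rewrite gerBl divr_ge0.
have le N : v N <= limn v by exact: nondecreasing_cvgn_le.
exists (limn v); split => //.
apply: lt_le_trans (le 1%N); rewrite /v zsumS zsum0 oddinvN sqrrN /oddinv /=.
by rewrite expr0n add0r invr1 expr1n addr_gt0.
Qed.

(* [c] is proportional to the sequence of Fourier coefficients of the indicator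
   function of a half circle whose mirror image is the complementary half circle,
   hence the product of the two Fourier series vanishes. *)
Lemma half_circle_sequence : exists c : int -> R[i], [/\ c 0 != 0,
  exists M : R, forall n, \sum_(0 <= i < n) sqmod (c (zenum i)) <= M &
  forall (j : int) (e : R), 0 < e -> exists N0, forall N, (N0 <= N)%N ->
    sqmod (zsum (fun z => c z * c (z + j)) N) < e].
Proof.
have [s [s0 cvs les]] := zsum_sqr_cvg.
(* The correlation at [j = 0] forces this value: [c_0^2 = s] must cancel the sum of the squares
   [(i / z)^2 = - 1 / z^2] over odd [z]. Numerically [r] is half of pi, so that [c] is pi times the
   coefficients of the indicator function of [(-pi, 0)]. *)
pose r := Num.sqrt s.
have rr : r * r = s by rewrite -expr2 sqr_sqrtr// ltW.
pose c (z : int) : R[i] := Complex (if z == 0 then r else 0) (oddinv z).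
exists c; split.
- apply/eqP => -[/eqP]; rewrite gt_eqF//; by rewrite sqrtr_gt0.
- exists (s + s) => n.
  have : \sum_(0 <= i < n) sqmod (c (zenum i)) <= zsum (fun z => sqmod (c z)) n.
    have nN : (n <= n.*2.+1)%N by rewrite -addnn leqW// leq_addr.
    rewrite /zsum (big_cat_nat (n := n) (leq0n n) nN) /=.
    by rewrite lerDl sumr_ge0// => i _; exact: sqmod_ge0.
  move/le_trans; apply; rewrite /sqmod /= zsumD lerD//.
  rewrite (_ : (fun z : int => _) = (fun z => if z == 0 then s else 0)); last first.
    by apply/funext => z; case: eqP; rewrite ?expr0n// expr2 rr.
  by rewrite (@zsum_delta _ (fun=> s) 0).
move=> j e e0.
have reE z : complex.Re (c z * c (z + j)) =
    (if z == 0 then (if j == 0 then s else 0) else 0) - oddinv z * oddinv (z + j).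
  rewrite /c /=; congr (_ - _); case: eqP => [->|]; last by rewrite mul0r.
  by rewrite add0r; case: ifP; rewrite ?mulr0.
have imE z : complex.Im (c z * c (z + j)) =
    (if z == 0 then r * oddinv j else 0) + (if z == - j then r * oddinv (- j) else 0).
  rewrite /c /= addr_eq0; congr (_ + _).
    by case: eqP => [->|]; rewrite ?add0r// mul0r.
  by case: eqP => [->|]; rewrite ?mulr0// mulrC.
have Re_sum N : complex.Re (zsum (fun z => c z * c (z + j)) N) =
    (if j == 0 then s else 0) - zsum (fun z => oddinv z * oddinv (z + j)) N.
  rewrite -(@zsum_delta _ (fun=> if j == 0 then s else 0) 0 N)//.
  rewrite /zsum raddf_sum -sumrB; apply: eq_bigr => i _; exact: reE.
(* Only [z = 0] and [z = -j] contribute, and they cancel because [oddinv] is odd; both lie in the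
   window once [|j| <= N]. *)
have Im_sum N : (`|j| <= N)%N -> complex.Im (zsum (fun z => c z * c (z + j)) N) = 0.
  move=> jN; rewrite /zsum raddf_sum (eq_bigr _ (fun i _ => imE (zenum i))).
  rewrite big_split /=.
  apply: etrans (congr2 +%R (zsum_delta (fun=> r * oddinv j) (leq0n N : (`|0%Z| <= N)%N))
    (zsum_delta (fun=> r * oddinv (- j)) (_ : (`|- j| <= N)%N))) _.
    by rewrite abszN.
  by rewrite oddinvN mulrN subrr.
have cv0 : (if j == 0 then s else 0) -
    zsum (fun z => oddinv z * oddinv (z + j)) N @[N --> \oo] --> (0 : R).
  have [j0|j0] := eqVneq j 0.
    rewrite -[X in _ --> X](subrr s); apply: cvgB; first exact: cvg_cst.
    apply: cvg_trans cvs; apply: near_eq_cvg; near=> N; rewrite j0.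
    by apply: eq_bigr => i _; rewrite addr0 expr2.
  rewrite -[X in _ --> X](subrr (0 : R)); apply: cvgB; first exact: cvg_cst.
  exact: cvg_zsum_corr.
have se0 : 0 < Num.sqrt e by rewrite sqrtr_gt0.
move/cvgrPdist_lt: cv0 => /(_ _ se0)[N0 _ hN].
exists (maxn N0 `|j|) => N; rewrite geq_max => /andP[N0N jN].
rewrite /sqmod Im_sum// Re_sum expr0n addr0.
have := hN N N0N; rewrite /= sub0r normrN => lt.
by rewrite -(real_normK (num_real (_ - _))) -(sqr_sqrtr (ltW e0)) ltrXn2r ?nnegrE// ltW.
Unshelve. all: by end_near. Qed.

End Convolution.

(** * Atoms with the same infinite path *)

Section UnitVectors.
Context (R : realType) (d : measure_display) (X : measurableType d).
Variable mu : {measure set X -> \bar R}.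
Implicit Types (f : X -> R[i]) (p q : atom mu).

Definition unitv q : X -> R[i] := fun x =>
  (Num.sqrt (weight q))^-1%:C%C * ind (rep q) x.

Lemma L2_unitv q : L2set mu (unitv q).
Proof. by apply: L2Z; exact: L2_rep. Qed.

Lemma fhat_unitv q p : fhat (unitv q) p = (`[< q = p >] : nat)%:R.
Proof.
rewrite /unitv fhatZ; last exact: L2_mfunC (L2_rep q).
case: asboolP => [<-|ne].
  rewrite fhat_ind_on; last exact: on_rep.
  by rewrite -rmorphM/= mulVf// gt_eqF// sqrtr_gt0 weight_gt0.
rewrite fhat_rst_off ?mulr0//; apply: on_neq.
by move=> E; apply: ne.
Qed.

Lemma L2_sum n (F : nat -> X -> R[i]) : (forall i, L2set mu (F i)) ->
  L2set mu (fun x => \sum_(0 <= i < n) F i x).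
Proof.
move=> F2; elim: n => [|n IH].
  rewrite (_ : (fun _ => _) = fun _ => 0); first exact: L2_0.
  by apply/funext => x; rewrite big_nil.
rewrite (_ : (fun _ => _) = fun x => \sum_(0 <= i < n) F i x + F n x).
  exact: L2D.
by apply/funext => x; rewrite big_nat_recr.
Qed.

Lemma fhat_sum n (F : nat -> X -> R[i]) p : (forall i, L2set mu (F i)) ->
  fhat (fun x => \sum_(0 <= i < n) F i x) p = \sum_(0 <= i < n) fhat (F i) p.
Proof.
move=> F2; elim: n => [|n IH].
  rewrite big_nil; apply: fhat_eq0; first exact: L2_mfunC (L2_sum 0 F2).
  by apply: aeW => x; rewrite big_nil.
rewrite big_nat_recr//= -IH -fhatD; [|exact: L2_mfunC (L2_sum n F2)|exact: L2_mfunC].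
by congr fhat; apply/funext => x; rewrite big_nat_recr.
Qed.

Variables (a : nat -> atom mu) (c : nat -> R[i]).
Hypothesis a_inj : injective a.

(** Representatives of distinct atoms may overlap in null sets; removing the others makes the
    supports disjoint everywhere, as step functions require. *)
Let B i := rep (a i) `&` \bigcap_j (if j == i then setT else ~` rep (a j)).

Let mB i : measurable (B i).
Proof.
apply: measurableI; first exact: m_rep.
apply: bigcapT_measurable => j; case: ifP => // _.
by apply: measurableC; exact: m_rep.
Qed.

Let tB : trivIset setT B.
Proof.
apply/trivIsetP => i j _ _ ij; apply/seteqP; split=> // x [[_ hi] [rj _]].
by have := hi j Logic.I; rewrite eq_sym (negbTE ij) => /(_ rj).
Qed.

Let onB i : on (a i) (B i).
Proof.
apply: onI; first exact: on_rep.
apply: on_bigcap => j; case: eqP => [_|ne]; first exact: onT.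
by apply: on_neq => /a_inj/esym.
Qed.

Lemma synthesis (M : R) :
  (forall n, \sum_(0 <= i < n) sqmod (c i) <= M) ->
  exists f, [/\ L2set mu f, forall i, fhat f (a i) = c i &
    forall p, (forall i, p <> a i) -> fhat f p = 0].
Proof.
move=> hM.
pose w i := Num.sqrt (weight (a i)).
have w0 i : w i != 0 by rewrite gt_eqF// sqrtr_gt0 weight_gt0.
pose cc i := (w i)^-1%:C%C * c i.
exists (stepf B cc); split.
- apply: (L2_stepf mB tB (M := M)) => n.
  apply: le_trans (_ : _ <= (\sum_(0 <= i < n) sqmod (c i))%:E)%E _; last first.
    by rewrite lee_fin.
  rewrite -sumEFin le_eqVlt; apply/orP; left; apply/eqP.
  apply: eq_bigr => i _.
  have -> : B i = rep (a i) `&` B i by rewrite /B setIA setIid.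
  rewrite mu_on// /cc sqmodM sqmodR exprVn sqr_sqrtr ?ltW ?weight_gt0//.
  by rewrite -EFinM mulrAC mulVf ?mul1r// gt_eqF// weight_gt0.
- move=> i; rewrite /fhat (@avalP _ _ _ _ _ (a i) (cc i)).
    by rewrite -/(w i) /cc mulrA -rmorphM/= mulfV ?mul1r.
  by apply: onS (onB i) => x Bx /=; rewrite (stepf_on tB cc Bx).
- move=> p pa; rewrite /fhat (@avalP _ _ _ _ _ p 0) ?mulr0//.
  have /on_bigcap : forall i, on p (~` rep (a i)).
    by move=> i; apply: on_neq; exact: pa.
  apply: onS => x h /=; rewrite stepf_off// => n [rx _].
  exact: (h n Logic.I rx).
Qed.

End UnitVectors.

Section Aperiodicity.
Context (k : nat) (L : kgraph k) (R : realType) (d : measure_display)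
  (X : measurableType d) (mu : {measure set X -> \bar R}) (S : LSBFS L mu).
Implicit Types (l : kpath L) (f g : X -> R[i]) (p q r : atom mu)
  (m : 'I_k -> nat).
Hypothesis irr : sbfs_irreducible S.

Lemma symmetry_comp (u v : atom mu -> atom mu) :
  symmetry S u -> symmetry S v -> symmetry S (u \o v).
Proof.
move=> [us usig] [vs vsig]; split=> [p|m p] /=; last by rewrite vsig usig.
exact: same_trans (vs p) (us _).
Qed.

Lemma symmetry_iter (u : atom mu -> atom mu) n :
  symmetry S u -> symmetry S (iter n u).
Proof.
by move=> us; elim: n => [|n IH]; [split|exact: (symmetry_comp us IH)].
Qed.

Section Powers.
Variables (u v : atom mu -> atom mu).
Hypotheses (uS : symmetry S u) (vS : symmetry S v) (uK : cancel u v)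
  (vK : cancel v u).

Definition zpow (j : int) : atom mu -> atom mu :=
  match j with Posz n => iter n u | Negz n => iter n.+1 v end.

Lemma symmetry_zpow j : symmetry S (zpow j).
Proof. by case: j => n; exact: symmetry_iter. Qed.

Lemma zpowS j p : zpow (j + 1) p = u (zpow j p).
Proof.
case: j => n; first by rewrite -PoszD addn1.
rewrite NegzE; have -> : - n.+1%:Z + 1 = - n%:Z by lia.
by case: n => [|n]; rewrite -?NegzE /= vK.
Qed.

Lemma zpowD i j p : zpow (i + j) p = zpow i (zpow j p).
Proof.
have zpowP z r : zpow (z - 1) r = v (zpow z r).
  by rewrite -[in RHS](subrK 1 z) zpowS uK.
elim: i => [|n|n].
- by rewrite add0r.
- by move=> IH; rewrite (_ : n.+1%:Z + j = n%:Z + j + 1) ?zpowS ?IH//; lia.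
- move=> IH; rewrite (_ : - n.+1%:Z + j = - n%:Z + j - 1); last by lia.
  by rewrite zpowP IH -zpowP (_ : - n%:Z - 1 = - n.+1%:Z)//; lia.
Qed.

Lemma free_orbit_false p : injective (fun j => zpow j p) -> False.
Proof.
move=> pinj.
have [c [c0 [M hM] hc]] := half_circle_sequence R.
have M0 : 0 <= M by have := hM 0%N; rewrite big_nil.
(* Conditions are imposed only at atoms with free orbit, where Bessel and Cauchy-Schwarz bound the
   partial sums uniformly in [N]. *)
pose D := [set r | injective (fun j => zpow j r)].
pose H (N i : nat) := c (zenum i).
pose U (N i : nat) := zpow (zenum i).
pose n (N : nat) := N.*2.+1.
have ellE N f r : ell n H U N f r = zsum (fun z => c z * fhat f (zpow z r)) N by [].
have [f [f2 fa f0]] := @synthesis _ _ _ mu (fun i => zpow (zenum i) p)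
  (fun i => c (zenum i)) (inj_comp pinj zenum_inj) M hM.
have {}fa j : fhat f (zpow j p) = c j.
  by have [i <-] := zenum_surj j.
have Usame i r : same S r (zpow i r) by case: (symmetry_zpow i).
have Usig i m r : zpow i (sig S m r) = sig S m (zpow i r).
  by case: (symmetry_zpow i).
case: (@ell_dichotomy _ _ _ _ _ mu S irr D n H U).
- move=> r m rD i j; rewrite /= !Usig => E; apply: rD.
  apply: same_sig_inj E; apply: same_trans (Usame j r).
  exact: same_sym.
- move=> r l rl rD i j /=.
  rewrite !(symmetry_tau (symmetry_zpow _) rl) => /(congr1 (sig S (kdeg l))).
  rewrite !sig_tau; [exact: rD|exact: same_sD rl|exact: same_sD rl].
- by move=> N i; exact: symmetry_zpow.
- move=> r rD; exists (M + 1); split; first by rewrite ltr_wpDl.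
  move=> N g g2; apply: le_trans (sqmod_cauchy _ _ _) _.
  apply: ler_pM.
  + by apply: sumr_ge0 => i _; exact: sqmod_ge0.
  + by apply: sumr_ge0 => i _; exact: sqmod_ge0.
  + by apply: le_trans (hM _) _; rewrite lerDl.
  + apply: bessel_fhat => //; first exact: iota_uniq.
    by move=> i j _ _ /rD/zenum_inj.
- move=> /(_ f) H0; have /H0 : ell_kernel D n H U f.
    split=> // r rD e e0.
    (* The vector with coordinates [c] along the orbit of [p] lies in the kernel: at [u^j p] the
       condition is the vanishing correlation of [c], and off the orbit all terms are zero. *)
    have [[j rE]|nr] := pselect (exists j, r = zpow j p).
      have [N0 hN] := hc j e e0; exists N0 => N /hN; rewrite ellE.
      congr (sqmod _ < _); apply: eq_bigr => i _.
      by rewrite rE -zpowD fa.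
    exists 0%N => N _; rewrite ellE /zsum big1 ?sqmod0// => i _.
    rewrite f0 ?mulr0// => i' E; apply: nr.
    exists (- zenum i + zenum i'); rewrite zpowD -E -zpowD addNr.
    by [].
  move=> /(fhat_eq0 p (L2_mfunC f2)); have := fa 0 => /= -> /eqP.
  by rewrite (negbTE c0).
- move=> /(_ _ (L2_unitv p))[_ /(_ p pinj)].
  (* The unit vector at [p] is outside the kernel, since the functional at [p] takes the value [c 0]
     on it. *)
  have c00 : 0 < sqmod (c 0).
    rewrite lt_def sqmod_ge0 andbT; apply/eqP => /sqmod_eq0 E.
    by rewrite E eqxx in c0.
  move=> /(_ _ c00)[N /(_ _ (leqnn N))]; rewrite ellE.
  rewrite (_ : zsum _ N = c 0) ?ltxx//.
  apply: etrans (zsum_delta c (leq0n N : (`|0%Z| <= N)%N)).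
  apply: eq_bigr => i _; rewrite fhat_unitv.
  case: eqP => [->|ne]; first by rewrite asboolT ?mulr1.
  by rewrite asboolF ?mulr0// => E; apply: ne; apply: pinj.
Qed.

Lemma periodic_orbit_false p n : (0 < n)%N -> iter n u p = p -> u p <> p -> False.
Proof.
move=> n0 per ne.
pose H (N i : nat) : R[i] := if i == 0%N then 1 else -1.
pose U (N i : nat) : atom mu -> atom mu := if i == 0%N then u else id.
have ellE N f r : ell (fun _ => 2) H U N f r = fhat f (u r) - fhat f r.
  by rewrite /ell !big_nat_recl// big_nil addr0 /H /U /= mul1r mulN1r.
(* An invariant vector: its coordinate at [r] counts how often [r] occurs among [n] steps of the
   orbit, so [n] may be any period. *)
pose f x := \sum_(0 <= j < n) unitv (iter j u p) x.
have u2 i : L2set mu (unitv (iter i u p)) by exact: L2_unitv.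
have f2 : L2set mu f by exact: L2_sum.
have fE r : fhat f r = (\sum_(0 <= j < n) (`[< iter j u p = r >] : nat))%:R.
  by rewrite fhat_sum// natr_sum; apply: eq_bigr => j _; rewrite fhat_unitv.
have finv r : fhat f (u r) = fhat f r.
  have {}per : iter n.-1.+1 u p = p by rewrite prednK.
  rewrite !fE; congr (_%:R); rewrite -(prednK n0).
  rewrite big_nat_recl// big_nat_recr//= addnC; congr (_ + _)%N.
    apply: eq_bigr => j _; congr nat_of_bool; apply: asbool_equiv_eq.
    by split => [/(can_inj uK)|->].
  congr nat_of_bool; apply: asbool_equiv_eq; split=> [E|<-]; last exact: esym per.
  by apply: (can_inj uK); rewrite -E; exact: per.
case: (@ell_dichotomy _ _ _ _ _ mu S irr setT (fun _ => 2) H U) => //.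
- by move=> N i; rewrite /U; case: ifP => // _; split.
- move=> r _; exists 4; split => // N g g2; rewrite ellE.
  apply: le_trans (sqmodD_le _ _) _; rewrite sqmodN.
  have := sqmod_fhat_le r g2; have := sqmod_fhat_le (u r) g2; lra.
- move=> /(_ f) H0; have /H0 : ell_kernel setT (fun _ => 2) H U f.
    split=> // r _ e e0; exists 0%N => N _.
    by rewrite ellE finv subrr sqmod0.
  move=> /(fhat_eq0 p (L2_mfunC f2))/eqP; rewrite fE pnatr_eq0.
  have -> : n = n.-1.+1 by rewrite prednK.
  by rewrite big_nat_recl//= asboolT.
- move=> /(_ _ (L2_unitv p))[_ /(_ p Logic.I 1 ltr01)][N /(_ _ (leqnn N))].
  rewrite ellE !fhat_unitv asboolF; last by move=> E; apply: ne.
  by rewrite asboolT// sub0r sqmodN -[1%:R]/(1%:C%C) sqmodR expr1n ltxx.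
Qed.

End Powers.

Lemma same_eq p q : same S p q -> p = q.
Proof.
move=> pq; apply: contrapT => ne.
have [a [b E]] := all_tail irr p q.
have [u [v [uS vS up uK vK]]] := shift_symmetry pq E (fun r => all_tail irr r p).
have [pinj|] := pselect (injective (fun j => zpow u v j p)).
  exact: (free_orbit_false uS vS uK vK pinj).
apply => i j /= Eij; apply: contrapT => ij.
wlog lt : i j Eij ij / i < j.
  move=> h; have [lt|lt|//] := ltgtP i j; first exact: (h i j).
  by apply: (h j i) => // ji; apply: ij.
apply: (@periodic_orbit_false u v uS uK p `|j - i|%N).
- by lia.
- have jiE : Posz `|j - i| = j - i by lia.
  rewrite -[iter _ u p]/(zpow u v (Posz `|j - i|) p) jiE addrC.
  by rewrite zpowD// -Eij -zpowD// addNr.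
- by rewrite up => /esym.
Qed.

End Aperiodicity.

(** * Cyclic vectors *)

Section Exhaustion.
Context (R : realType) (d : measure_display) (X : measurableType d).
Variable mu : {measure set X -> \bar R}.

Lemma rst_exhaust (C : nat -> set X) (f : X -> R[i]) (e : R) :
  nondecreasing_seq C -> (forall n, measurable (C n)) ->
  mu.-negligible (~` \bigcup_n C n) -> L2set mu f -> 0 < e ->
  exists n, fine (n2 mu (rst (~` C n) f)) < e.
Proof.
move=> ndC mC nC f2 e0; have mf := L2_mfunC f2.
have mE (D : set X) : measurable_fun D (fun x => (sqmod (f x))%:E).
  exact: measurable_sqmodE.
have sq0 x : (0 <= (sqmod (f x))%:E)%E by rewrite lee_fin sqmod_ge0.
have mU : measurable (\bigcup_n C n) by exact: bigcupT_measurable.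
have cv := @ge0_nondecreasing_set_cvg_integral _ _ _ C (fun x => (sqmod (f x))%:E)
  mu ndC mC (fun i => mE (C i)) (fun i x _ => sq0 x).
have E1 : (\int[mu]_(x in \bigcup_n C n) (sqmod (f x))%:E)%E = n2 mu f.
  rewrite -n2_rst; apply: n2_ae => //; first exact: mfunC_rst.
  by apply: negligibleS nC => x /= ne Cx; apply: ne; rewrite /rst asboolT.
rewrite {}E1 (n2_fin f2) in cv.
have splitE n : n2 mu f = (n2 mu (rst (C n) f) + n2 mu (rst (~` C n) f))%E.
  rewrite !n2_rst -ge0_integral_setU ?setUv//; first exact: measurableC.
  by apply/disj_setPS => x [].
have r2 n : L2set mu (rst (C n) f) by exact: L2_rst.
have r2' n : L2set mu (rst (~` C n) f) by apply: L2_rst => //; exact: measurableC.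
have fineE n : fine (n2 mu (rst (~` C n) f)) =
    fine (n2 mu f) - fine (n2 mu (rst (C n) f)).
  have := splitE n; rewrite (n2_fin f2) (n2_fin (r2 n)) (n2_fin (r2' n)) -EFinD.
  by move=> [->]; rewrite addrC addKr.
have {}cv : fine (n2 mu (rst (C n) f)) @[n --> \oo] --> fine (n2 mu f).
  apply: fine_cvg; rewrite -(n2_fin f2) in cv *; rewrite (n2_fin f2).
  by under eq_fun do rewrite n2_rst; rewrite -(n2_fin f2).
move/cvgrPdist_lt: cv => /(_ _ e0)[n _ /(_ n (leqnn n)) h].
exists n; rewrite fineE; apply: le_lt_trans h; exact: ler_norm.
Qed.

End Exhaustion.

Section Monic.
Context (k : nat) (L : kgraph k) (R : realType) (d : measure_display)
  (X : measurableType d) (mu : {measure set X -> \bar R}) (S : LSBFS L mu).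
Implicit Types (l : kpath L) (f g : X -> R[i]) (p q : atom mu)
  (m : 'I_k -> nat).
Hypothesis irr : sbfs_irreducible S.

Lemma positive_vector : exists xi : X -> R[i], L2set mu xi /\
  forall p, fhat xi p != 0.
Proof.
pose V n := if unpickle n is Some v then sR S (kid v) else set0.
have mV n : measurable (V n) by rewrite /V; case: unpickle => // v; exact: m_sR.
pose B := seqDU V.
have mB n : measurable (B n).
  by apply: measurableD => //; apply: bigsetU_measurable.
have tB : trivIset setT B by exact: trivIset_seqDU.
have fB n : (mu (B n) < +oo)%E.
  apply: (@le_lt_trans _ _ (mu (V n))).
    by apply: le_measure; rewrite ?inE//; exact: subset_seqDU.
  rewrite /V; case: unpickle => [v|]; first exact: sR_fin.
  by rewrite measure0.
(* Positive, with [t n * mu (B n) <= 2^-n]; the added [1] keeps the denominator positive when [B n]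
   is null. *)
pose t n : R := 2^-1 ^+ n / (1 + fine (mu (B n))).
have b0 n : 0 <= fine (mu (B n)) by rewrite fine_ge0.
have t0 n : 0 < t n by rewrite divr_gt0 ?exprn_gt0// ltr_pwDl.
pose c n : R[i] := (Num.sqrt (t n))%:C%C.
have xi2 : L2set mu (stepf B c).
  apply: (L2_stepf mB tB (M := 2)) => n.
  apply: (@le_trans _ _ (2 - 2 * 2^-1 ^+ n)%:E); last first.
    by rewrite lee_fin gerBl mulr_ge0// exprn_ge0.
  elim: n => [|n IH]; first by rewrite big_nil expr0 mulr1 subrr.
  have bE : mu (B n) = (fine (mu (B n)))%:E by rewrite fineK// ge0_fin_numE.
  have tn : ((sqmod (c n))%:E * mu (B n) <= (2^-1 ^+ n)%:E)%E.
    rewrite bE -EFinM lee_fin /c sqmodR sqr_sqrtr ?(ltW (t0 n))// /t -mulrA.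
    rewrite ler_piMr ?exprn_ge0// mulrC ler_pdivrMr ?ltr_pwDl//.
    by rewrite mul1r lerDr.
  rewrite big_nat_recr//=; apply: le_trans (leeD IH tn) _.
  rewrite -EFinD lee_fin exprS; lra.
exists (stepf B c); split => // p.
apply/eqP => E.
have pU : on p (\bigcup_n B n).
  rewrite -seqDU_bigcup_eq.
  have := on_null p (vertex_cover S); rewrite setCK; apply: onS => x [v _ Rx].
  by exists (pickle v) => //; rewrite /V pickleK.
have [n pn] := on_bigcup mB pU.
have : aval (stepf B c) p = c n.
  by apply: avalP; apply: onS pn => x Bx /=; rewrite (stepf_on tB c Bx).
move=> aE; move: E; rewrite /fhat aE -rmorphM/=.
move=> /(congr1 (@complex.Re R)) /= /eqP; apply/negP.
by rewrite mulf_neq0// gt_eqF// sqrtr_gt0// weight_gt0.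
Qed.

Section Approximation.
Variables (xi : X -> R[i]).
Hypothesis (xi2 : L2set mu xi).

Definition admissible (s : seq ((R[i] * kpath L) * (X -> R[i]))) :=
  forall t, List.In t s -> is_adj_image mu (sbfs_op S t.1.2) xi t.2.

Definition combine (s : seq ((R[i] * kpath L) * (X -> R[i]))) : X -> R[i] :=
  fun x => \sum_(t <- s) t.1.1 * sbfs_op S t.1.2 t.2 x.

(** The tolerance bounds the squared distance. *)
Definition approximable f := forall e : R, 0 < e -> exists s,
  admissible s /\ fine (n2 mu (fun x => f x - combine s x)) < e.

Lemma L2_combine s : admissible s -> L2set mu (combine s).
Proof.
elim: s => [|p s IH] h.
  rewrite (_ : combine _ = fun _ => 0); first exact: L2_0.
  by apply/funext => x; rewrite /combine big_nil.
rewrite (_ : combine _ = fun x => p.1.1 * sbfs_op S p.1.2 p.2 x + combine s x).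
  apply: L2D; last by apply: IH => q qs; apply: h; right.
  by apply: L2Z; apply: L2_op; have [] := h p (or_introl erefl).
by apply/funext => x; rewrite /combine big_cons.
Qed.

Lemma approximableD f g : L2set mu f -> L2set mu g ->
  approximable f -> approximable g -> approximable (fun x => f x + g x).
Proof.
move=> f2 g2 hf hg e e0; have e4 : 0 < e / 4 by rewrite divr_gt0.
have [s [as_ sf]] := hf _ e4; have [t [at_ tg]] := hg _ e4.
exists (s ++ t); split.
  by move=> p ps; have [h|h] := List.in_app_or _ _ _ ps; [exact: as_|exact: at_].
rewrite (_ : (fun x => _) =
    (fun x => (f x - combine s x) + (g x - combine t x))); last first.
  by apply/funext => x; rewrite /combine big_cat/= opprD addrACA.
apply: le_lt_trans (fine_n2D _ _) _.
- by apply: L2B => //; exact: L2_combine.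
- by apply: L2B => //; exact: L2_combine.
- by lra.
Qed.

Lemma approximable_lim f : L2set mu f ->
  (forall e : R, 0 < e -> exists g, [/\ L2set mu g, approximable g &
    fine (n2 mu (fun x => f x - g x)) < e]) -> approximable f.
Proof.
move=> f2 h e e0; have e4 : 0 < e / 4 by rewrite divr_gt0.
have [g [g2 /(_ _ e4)[s [as_ sg]] fg]] := h _ e4.
exists s; split=> //.
rewrite (_ : (fun x => _) =
    (fun x => (f x - g x) + (g x - combine s x))); last first.
  by apply/funext => x; rewrite addrA subrK.
apply: le_lt_trans (fine_n2D _ _) _.
- exact: L2B.
- by apply: L2B => //; exact: L2_combine.
- by lra.
Qed.

Lemma approximable_ae f g : L2set mu f -> L2set mu g ->
  {ae mu, forall x, f x = g x} -> approximable g -> approximable f.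
Proof.
move=> f2 g2 fg hg; apply: approximable_lim => // e e0; exists g; split => //.
have fg2 := L2B f2 g2.
have -> : n2 mu (fun x => f x - g x) = n2 mu (fun _ => 0).
  apply: n2_ae; [exact: L2_mfunC fg2|exact: mfunC_cst|].
  by apply: filterS fg => x ->; rewrite subrr.
by rewrite n2_0.
Qed.

Lemma approximable0 : approximable (fun _ => 0).
Proof.
move=> e e0; exists [::]; split=> //.
rewrite (_ : (fun _ => _) = fun _ => 0); first by rewrite n2_0.
by apply/funext => x; rewrite /combine big_nil subrr.
Qed.

Lemma approximable_range c l : approximable (fun x => c * rst (sR S l) xi x).
Proof.
have r2 : L2set mu (fun x => c * rst (sR S l) xi x).
  by apply: L2Z; apply: L2_rst => //; exact: m_sR.
have a2 := L2_adj S l xi2; have o2 := L2_op S l a2.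
apply: (@approximable_ae _ (fun x => c * sbfs_op S l (adj_op S l xi) x)) => //.
- exact: L2Z.
- by apply: filterS (op_adj S l xi) => x ->.
move=> e e0; exists [:: ((c, l), adj_op S l xi)]; split.
  by move=> _ [<-|[]]; exact: adj_opP.
rewrite (_ : (fun _ => _) = fun _ => 0); first by rewrite n2_0.
by apply/funext => x; rewrite /combine big_seq1 subrr.
Qed.

Variable a0 : atom mu.

Lemma negl_atoms (Z : set X) : measurable Z ->
  (forall p, ~ on p Z) -> mu.-negligible Z.
Proof. exact: no_atom_negligible irr a0 Z. Qed.

(** The sets [R_l] along the path of [q] shrink to [q], and [xi] has the constant value [v] on [q].
    Hence [c / v] times the restriction of [xi] to [R_l] differs from the target only off [q], by a
    multiple of a vanishing tail of [xi]. *)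
Lemma approximable_atom c q : fhat xi q != 0 ->
  approximable (fun x => c * ind (rep q) x).
Proof.
move=> xiq.
have mxi := L2_mfunC xi2.
have /choice[lab labP] : forall n : nat, exists l,
    kdeg l = (fun _ => n) /\ on q (sR S l) by move=> n; exact: label_ex.
(* If [(n, ..., n)] dominates the degree of [l], unique factorization makes [l] an initial segment
   of [lab n]; the diagonal degrees thus determine the whole path. *)
have prefix l n p : on q (sR S l) -> (forall i, kdeg l i <= n)%N ->
    on p (sR S (lab n)) -> on p (sR S l).
  move=> ql ln pn; have [ld qn] := labP n.
  have : kdeg (lab n) = degadd (kdeg l) (fun i => n - kdeg l i)%N.
    by rewrite ld; apply/funext => i; rewrite /degadd subnKC.
  move=> /kfact[[b b'] [/= [e bl _ lE] _]].
  move: qn pn; rewrite lE => /(on_sR_comp _ _ e)[qb _] /(on_sR_comp _ _ e)[pb _].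
  by rewrite -(label_uniq bl qb ql).
(* The sets [R_(lab n)] are nested only up to null sets; the finite intersections decrease
   everywhere. *)
pose G n := \bigcap_(i in [set i | (i <= n)%N]) sR S (lab i).
have mG n : measurable (G n).
  by apply: bigcap_measurable => [|i _]; [exists 0%N|exact: m_sR].
pose C n := ~` (G n `\` rep q).
have mC n : measurable (C n).
  by apply: measurableC; apply: measurableD => //; exact: m_rep.
have ndC : nondecreasing_seq C.
  move=> n n' nn'; apply/subsetPset; apply: subsetC; apply: setSD.
  by move=> x h i /= ij; apply: h => /=; exact: leq_trans nn'.
have nC : mu.-negligible (~` \bigcup_n C n).
  apply: negl_atoms; first by apply: measurableC; exact: bigcupT_measurable.
  move=> p pC.
  have pn n : on p (sR S (lab n)).
    apply: onS pC => x /= h; apply: contrapT => nR; apply: h.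
    by exists n => // -[/(_ n (leqnn n))].
  suff E : q = p.
    have [x [h rx]] := on_both pC (on_rep p).
    by apply: h; exists 0%N => // -[_]; rewrite E.
  apply: (same_eq irr); apply: same_sub => l ql.
  apply: (prefix l (\max_i kdeg l i)) => // i; exact: leq_bigmax.
pose v := aval xi q.
have v0 : v != 0 by apply: contra xiq => /eqP; rewrite /fhat -/v => ->; rewrite mulr0.
have c2 : L2set mu (fun x => c * ind (rep q) x) by apply: L2Z; exact: L2_rep.
apply: approximable_lim => // e e0.
pose w := sqmod (c / v).
have w0 : 0 <= w by exact: sqmod_ge0.
have w1 : 0 < w + 1 by rewrite ltr_wpDl.
have [n hn] := rst_exhaust ndC mC nC xi2 (divr_gt0 e0 w1).
exists (fun x => (c / v) * rst (sR S (lab n)) xi x).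
have r2 : L2set mu (fun x => (c / v) * rst (sR S (lab n)) xi x).
  by apply: L2Z; apply: L2_rst => //; exact: m_sR.
split => //; first exact: approximable_range.
have R2 : L2set mu (rst (~` C n) xi) by apply: L2_rst => //; exact: measurableC.
have m2 := L2_mfunC R2.
rewrite (@n2_ae _ _ _ mu _ (fun x => - (c / v) * rst (~` C n) xi x)); first last.
- have n1 : mu.-negligible (sR S (lab n) `\` G n).
    apply: negl_atoms; first by apply: measurableD => //; exact: m_sR.
    move=> p pn.
    have pG : on p (G n).
      have h i : on p (if (i <= n)%N then sR S (lab i) else setT).
        case: ifP => [ni|_]; last exact: onT.
        have [ld qi] := labP i.
        apply: (prefix _ n) => //; first by move=> j; rewrite ld.
        by apply: onS pn => x [].
      by apply: onS (on_bigcap h) => x hx i /= ni; have := hx i Logic.I; rewrite ni.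
    by have [x [[_ nG] /nG]] := on_both pn pG.
  have [_ qn] := labP n.
  have /onE n3 := onI qn (on_aval q mxi).
  apply: negligibleS (negligibleU n1 n3) => x /= ne.
  have [rx|nrx] := pselect (rep q x).
    right; split=> // -[Rx /= xv]; apply: ne.
    have nC' : ~ (~` C n) x by move=> h; apply: h => -[].
    by rewrite (indT _ rx) (rstT _ Rx) (rstF _ nC') mulr0 xv -/v mulfVK// mulr1 subrr.
  left; have [Rx|nRx] := pselect (sR S (lab n) x); last first.
    exfalso; apply: ne; have nC' : ~ (~` C n) x.
      by move=> /contrapT[/(_ n (leqnn n))].
    by rewrite (indF _ nrx) (rstF _ nRx) (rstF _ nC') !mulr0 subrr.
  split=> // Gx; apply: ne; have C' : (~` C n) x by move=> h; apply: h.
  by rewrite (indF _ nrx) (rstT _ Rx) (rstT _ C') mulr0 sub0r mulNr.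
- by apply: mfunCM => //; exact: mfunC_cst.
- exact: L2_mfunC (L2B c2 r2).
rewrite n2Z// sqmodN (n2_fin R2) -EFinM /= -/w.
move: hn; rewrite ltr_pdivlMr//; have := fine_n2_ge0 mu (rst (~` C n) xi).
by set y := fine _; nra.
Qed.

(** By tail equivalence every atom is a prefixed shift of [a0]. The degree of the shift is encoded
    by a path [l'] of that degree, so pairs of paths enumerate all atoms. *)
Lemma atom_enum : exists a : nat -> atom mu, forall p, exists i, a i = p.
Proof.
exists (fun i => if unpickle i is Some (l, l')
  then tau S l (sig S (kdeg (l' : kpath L)) a0) else a0) => p.
have [m [n E]] := all_tail irr p a0.
have [l [lm pl]] := label_ex S p m; have [l' [ln _]] := label_ex S a0 n.
exists (pickle (l, l')); rewrite pickleK ln -E -lm.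
exact: tau_sig.
Qed.

(** Finite unions of atoms exhaust [X] up to a null set, and on each atom [f] is almost everywhere a
    multiple of the indicator function. *)
Lemma approximable_all f : (forall q, fhat xi q != 0) -> L2set mu f ->
  approximable f.
Proof.
move=> xi0 f2; have mf := L2_mfunC f2.
have [a asurj] := atom_enum.
pose Y := fix Y n := if n is n'.+1 then Y n' `|` rep (a n') else set0.
have mY n : measurable (Y n).
  by elim: n => [|n IH] //=; apply: measurableU => //; exact: m_rep.
have ndY : nondecreasing_seq Y.
  by apply/nondecreasing_seqP => n; apply/subsetPset => x; left.
have nY : mu.-negligible (~` \bigcup_n Y n).
  apply: negl_atoms; first by apply: measurableC; exact: bigcupT_measurable.
  move=> p /(on_both (on_rep p))[x [rx h]]; apply: h.
  by have [i ip] := asurj p; exists i.+1 => //=; right; rewrite ip.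
have apY n : approximable (rst (Y n) f).
  elim: n => [|n IH].
    rewrite (_ : rst _ _ = fun _ => 0); first exact: approximable0.
    by apply/funext => x; rewrite rstF.
  pose W := rep (a n) `\` Y n.
  have mW : measurable W by apply: measurableD => //; exact: m_rep.
  have W2 : L2set mu (rst W f) by exact: L2_rst.
  rewrite (_ : rst _ _ = fun x => rst (Y n) f x + rst W f x); last first.
    apply/funext => x; have [Yx|nY'] := pselect (Y n x).
      have nW : ~ W x by case.
      by rewrite (rstT _ Yx) (rstF _ nW) addr0 rstT//; left.
    have [rx|nrx] := pselect (rep (a n) x).
      have Wx : W x by [].
      by rewrite (rstF _ nY') (rstT _ Wx) add0r rstT//; right.
    have nW : ~ W x by case.
    by rewrite (rstF _ nY') (rstF _ nW) addr0 rstF//; case.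
  apply: approximableD => //; first exact: L2_rst.
  have [aY|naY] := on_or (a n) (mY n).
    apply: (@approximable_ae _ (fun _ => 0)) => //; last exact: approximable0.
      exact: L2_0.
    have /onE := aY; apply: negligibleS => x /= ne; apply: contrapT => nW.
    by apply: ne; rewrite rstF.
  apply: (@approximable_ae _ (fun x => aval f (a n) * ind (rep (a n)) x)) => //.
  - by apply: L2Z; exact: L2_rep.
  - have /onE := onI naY (on_aval (a n) mf); apply: negligibleS => x /= ne.
    have [rx|nrx] := pselect (rep (a n) x).
      split=> // -[nYx /= fx]; apply: ne.
      by rewrite (indT _ rx) rstT// mulr1.
    by exfalso; apply: ne; rewrite (indF _ nrx) rstF ?mulr0//; case.
  - exact: approximable_atom.
apply: approximable_lim => // e e0.
have [n hn] := rst_exhaust ndY mY nY f2 e0.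
exists (rst (Y n) f); split => //; first exact: L2_rst.
rewrite (_ : (fun x => _) = rst (~` Y n) f)//.
apply/funext => x; have [Yx|nYx] := pselect (Y n x).
  by rewrite (rstT _ Yx) rstF ?subrr// => /(_ Yx).
by rewrite (rstF _ nYx) rstT// subr0.
Qed.

End Approximation.

(** The given atom may have infinite measure. One of the countably many vertex sets meets it in
    positive measure, and that intersection is an atom of finite measure. *)
Lemma has_atom_inhabited : has_atom mu -> inhabited (atom mu).
Proof.
move=> [A [mA A0 Aat]].
have [v Av] : exists v : kvert L, (0 < mu (A `&` sR S (kid v)))%E.
  apply: contrapT => /forallNP h.
  have nA : mu.-negligible A.
    apply: (@negligibleS _ _ _ _ (\bigcup_(v : kvert L) (A `&` sR S (kid v)) `|`
        ~` \bigcup_(v : kvert L) sR S (kid v))).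
      move=> x Ax; have [[v _ Rx]|nR] := pselect ((\bigcup_(v : kvert L) sR S (kid v)) x).
        by left; exists v.
      by right.
    apply: negligibleU; last exact: vertex_cover.
    apply: negligible_countable => v; apply/negligibleP.
      by apply: measurableI => //; exact: m_sR.
    by apply/eqP; have /negP := h v; rewrite lt0e measure_ge0 andbT negbK.
  by rewrite (measure_negligible mA nA) ltxx in A0.
have mAv : measurable (A `&` sR S (kid v)) by apply: measurableI => //; exact: m_sR.
have [|p _] := @mk_atom _ _ _ mu (A `&` sR S (kid v)); last exact: (inhabits p).
split=> //.
  apply: le_lt_trans (sR_fin S (kid v)); apply: le_measure; rewrite ?inE//.
    exact: m_sR.
move=> B mB BA; have [|B0|B0] := Aat B mB; first by move=> x /BA[].
  by left.
right; apply: (subset_measure0 _ _ _ B0).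
- exact: measurableD.
- exact: measurableD.
- by move=> x [[Ax _] nB].
Qed.

End Monic.

Theorem theorem5p4 (k : nat) (L : kgraph k) (R : realType)
  (d : measure_display) (X : measurableType d)
  (mu : {measure set X -> \bar R}) (S : LSBFS L mu) :
  row_finite L -> source_free L -> has_atom mu ->
  sbfs_irreducible S -> sbfs_monic S.
Proof.
move=> _ _ /(has_atom_inhabited S)[a0] irr; split.
  move=> l.
  (* [D_l] has positive measure, hence contains an atom [p]; [pi(s_l)] sends the unit vector at [p]
     to a vector with coordinate [1] at [tau l p]. *)
  have [p pl] : exists p : atom mu, on p (sD S l).
    apply: contrapT => /forallNP/(no_atom_negligible irr a0 (m_sD S l)).
    move/(measure_negligible (m_sD S l)) => E.
    by have := sD_pos S l; rewrite E ltxx.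
  have u2 := L2_unitv p; exists (unitv p); split=> // z.
  have := fhat_eq0 (tau S l p) (mfunC_op S l (L2_mfunC u2)) z.
  rewrite fhat_op; last exact: (L2_mfunC u2).
  rewrite asboolT; last exact: on_tauR.
  rewrite sig_tau// fhat_unitv asboolT// => /eqP.
  by rewrite oner_eq0.
have [xi [xi2 xi0]] := positive_vector S.
exists xi; split=> // f f2 e e0.
have [s [sa sf]] := approximable_all irr xi2 a0 xi0 f2 (exprn_gt0 2 e0).
by exists s; split => //; rewrite l2dist_lt.
Qed.
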